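(* Let $F$ be a finitely generated nonabelian free group, and let $P \subset F$ be the positive cone of a bi-ordering of $F$. Suppose that $H$ is a finitely generated group, and that the centre $Z(H)$ contains a free abelian group with free generators $\{a_g\}_{g \in P}$ (indexed by $P$). For a subset $S \subset P$, let $A_S$ denote the subgroup of $Z(H)$ generated by $\{a_g\}_{g \in S}$ (so $A_\emptyset$ is trivial). Suppose further that: (1) the group $H/A_S$ is bi-orderable for all $S \subset P$; and (2) if $S, S' \subset P$ and there exists $h \in F$ such that $S' = hSh^{-1}$, then $H/A_S \cong H/A_{S'}$. Then $(\mathcal{BO}, \cong)$ is weakly universal, where $\mathcal{BO}$ is the standard Borel space of finitely generated bi-orderable groups and $\cong$ is the relation on $\mathcal{BO}$ given by $N \cong M$ if and only if the groups $\mathbb{F}_\infty/N$ and $\mathbb{F}_\infty/M$ are isomorphic.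
   Context: A bi-ordering of a group $G$ is a strict total ordering $<$ of $G$ that is invariant under left and right multiplication; $G$ is bi-orderable if it admits a bi-ordering. The positive cone of a bi-ordering $<$ is $P = \{g \in G : g > id\}$. $\mathbb{F}_\infty$ is the free group on the countably infinite set $\{x_i : i \in \mathbb{N}\}$. The power set $2^{\mathbb{F}_\infty}$ carries the product topology, with subbasis the sets $\{S : g \in S\}$ and $\{S : g \notin S\}$ for $g \in \mathbb{F}_\infty$. $\mathcal{N} \subset 2^{\mathbb{F}_\infty}$ is the set of all normal subgroups of $\mathbb{F}_\infty$ that contain all but finitely many of the $x_i$. $\mathcal{BO}$ is the set of all $N \in \mathcal{N}$ such that $\mathbb{F}_\infty/N$ is bi-orderable; it is a Borel subset of $2^{\mathbb{F}_\infty}$ and is regarded as a standard Borel space with the inherited Borel structure. The relation $\cong$ on $\mathcal{BO}$ is a countable Borel equivalence relation. An equivalence relation $E$ on a standard Borel space $X$ is Borel if $E$ is a Borel subset of $X \times X$, and a Borel equivalence relation is countable if every equivalence class is countable. For countable Borel equivalence relations $E$ on $X$ and $F$ on $Y$, $E$ is weakly Borel reducible to $F$ (written $E \leq^w_B F$) if there is a countable-to-one Borel map $f \colon X \to Y$ such that $x \mathbin{E} y \implies f(x) \mathbin{F} f(y)$ for all $x,y \in X$. A countable Borel equivalence relation $E$ is weakly universal if $F \leq^w_B E$ for every countable Borel equivalence relation $F$. *)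

(* Defs.v *)
From HB Require Import structures.
From mathcomp Require Import all_boot all_order all_algebra.
From mathcomp Require Import all_classical all_reals all_analysis.

Set Implicit Arguments.
Unset Strict Implicit.
Unset Printing Implicit Defensive.

Local Open Scope classical_set_scope.
Local Open Scope group_scope.

(** * Groups

    [groupType] is the library's type of arbitrary, possibly infinite, groups;
    the library has neither subgroups given by classical sets, nor quotients,
    nor free groups at that level of generality. *)

Definition is_subgroup (G : groupType) (A : set G) : Prop :=
  A 1 /\ forall x y, A x -> A y -> A (x / y).

Definition is_normal_subgroup (G : groupType) (A : set G) : Prop :=
  is_subgroup A /\ forall x g, A x -> A (x ^ g).

Definition generated (G : groupType) (A : set G) : set G :=
  smallest (@is_subgroup G) A.

Definition finitely_generated (G : groupType) : Prop :=
  exists2 A : set G, finite_set A & generated A = setT.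

Definition abelian_group (G : groupType) : Prop := forall x y : G, commute x y.

Definition centre (G : groupType) : set G :=
  [set z | forall x, commute z x].

Definition group_isomorphic (G H : groupType) : Prop :=
  exists f : {multiplicative G -> H}, bijective f.

Definition bi_ordering (G : groupType) (lt : G -> G -> Prop) : Prop :=
  [/\ forall x, ~ lt x x,
      forall x y z, lt x y -> lt y z -> lt x z,
      forall x y, x <> y -> lt x y \/ lt y x &
      forall x y z, lt x y -> lt (z * x) (z * y) /\ lt (x * z) (y * z)].

Definition bi_orderable (G : groupType) : Prop :=
  exists lt : G -> G -> Prop, bi_ordering lt.

Definition positive_cone (G : groupType) (lt : G -> G -> Prop) : set G :=
  [set g | lt 1 g].

(** ** Quotients *)

Record normal_subgroup (G : groupType) := NormalSubgroup {
  normal_carrier :> G -> Prop;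
  normal_carrierP : is_normal_subgroup normal_carrier }.

Section Quotient.
Variables (G : groupType) (N : normal_subgroup G).

Lemma normal1 : N 1.
Proof. by case: N => A [[]]. Qed.

Lemma normalV x : N x -> N x^-1.
Proof.
by case: N => A [[A1 AB] _] /= Ax; rewrite -[x^-1]mul1g; exact: AB.
Qed.

Lemma normalM x y : N x -> N y -> N (x * y).
Proof.
move=> Nx /normalV Ny; rewrite -[y]invgK.
by move: Nx Ny; case: N => A [[A1 AB] _] /=; exact: AB.
Qed.

Lemma normalJ x g : N x -> N (x ^ g).
Proof. by case: N => A [_ AJ] /=; exact: AJ. Qed.

Definition same_coset : rel G := fun x y => `[< N (x^-1 * y) >].

Lemma same_cosetP x y : reflect (N (x^-1 * y)) (same_coset x y).
Proof. exact: asboolP. Qed.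

Lemma same_coset_equiv : equiv_class_of same_coset.
Proof.
split=> [x|x y|y x z].
- by apply/same_cosetP; rewrite mulVg; exact: normal1.
- by apply/same_cosetP/same_cosetP => /normalV; rewrite invgM invgK.
- move=> /same_cosetP xy /same_cosetP yz; apply/same_cosetP.
  by move: (normalM xy yz); rewrite mulgA mulgK.
Qed.

Canonical same_coset_rel := EquivRelPack same_coset_equiv.

Definition quotient := {eq_quot same_coset_rel}%qT.
HB.instance Definition _ := Choice.on quotient.

Definition coset (x : G) : quotient := (\pi x)%qT.

Lemma coset_eq x y : coset x = coset y <-> N (x^-1 * y).
Proof.
by split=> [/eqquotP/same_cosetP|Nxy] //; exact/eqquotP/same_cosetP.
Qed.

Lemma coset_repr (u : quotient) : coset (repr u) = u.
Proof. exact: reprK. Qed.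

Definition quotient_mul (u v : quotient) : quotient :=
  coset (repr u * repr v).
Definition quotient_one : quotient := coset 1.
Definition quotient_inv (u : quotient) : quotient := coset (repr u)^-1.

Lemma quotient_mulE x y : quotient_mul (coset x) (coset y) = coset (x * y).
Proof.
apply/coset_eq; have /coset_eq Nx := coset_repr (coset x).
have /coset_eq Ny := coset_repr (coset y).
set x' := repr _ in Nx *; set y' := repr _ in Ny *.
suff -> : (x' * y')^-1 * (x * y) = (x'^-1 * x) ^ y' * (y'^-1 * y).
  by apply: normalM => //; exact: normalJ.
by rewrite /conjg invgM -!mulgA mulVKg.
Qed.

Lemma quotient_invE x : quotient_inv (coset x) = coset x^-1.
Proof.
apply/coset_eq; have /coset_eq := coset_repr (coset x).
set x' := repr _ => /normalV /(@normalJ _ x^-1).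
by rewrite /conjg !invgK invgM invgK mulgA mulVKg.
Qed.

Lemma quotient_mulA : associative quotient_mul.
Proof.
move=> u v w; rewrite -(coset_repr u) -(coset_repr v) -(coset_repr w).
by rewrite !quotient_mulE mulgA.
Qed.

Lemma quotient_mul1 : left_id quotient_one quotient_mul.
Proof.
by move=> u; rewrite -(coset_repr u) quotient_mulE mul1g.
Qed.

Lemma quotient_1mul : right_id quotient_one quotient_mul.
Proof.
by move=> u; rewrite -(coset_repr u) quotient_mulE mulg1.
Qed.

Lemma quotient_mulV : left_inverse quotient_one quotient_inv quotient_mul.
Proof.
by move=> u; rewrite -(coset_repr u) quotient_invE quotient_mulE mulVg.
Qed.

Lemma quotient_Vmul : right_inverse quotient_one quotient_inv quotient_mul.
Proof.
by move=> u; rewrite -(coset_repr u) quotient_invE quotient_mulE mulgV.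
Qed.

HB.instance Definition _ := isGroup.Build quotient quotient_mulA
  quotient_mul1 quotient_1mul quotient_mulV quotient_Vmul.

End Quotient.

(** ** Free groups, as groups of reduced words

    The letter [(t, false)] stands for the generator [t], and [(t, true)] for
    its inverse. *)

Section FreeGroup.
Variable T : choiceType.
Implicit Types (l : T * bool) (s u v w : seq (T * bool)).

Definition inv_letter l : T * bool := (l.1, ~~ l.2).

Definition reduced w : bool :=
  sorted (fun l l' => l' != inv_letter l) w.

Definition push l w : seq (T * bool) :=
  if w is l' :: w' then if l' == inv_letter l then w' else l :: w
  else [:: l].

Record free_group := FreeGroup { word : seq (T * bool); _ : reduced word }.
HB.instance Definition _ := [isSub for word].
HB.instance Definition _ := [Choice of free_group by <:].

Lemma inv_letterK : involutive inv_letter.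
Proof. by case=> t b; rewrite /inv_letter /= negbK. Qed.

Lemma reduced_cons l w : reduced (l :: w) -> reduced w.
Proof. exact: path_sorted. Qed.

Lemma reduced_push l w : reduced w -> reduced (push l w).
Proof.
case: w => [//|l' w] rw /=; case: ifPn => [_|ll']; first exact: path_sorted rw.
by rewrite /reduced /= ll'.
Qed.

Lemma pushK l w : reduced w -> push (inv_letter l) (push l w) = w.
Proof.
case: w => [|l' w] rw /=; first by rewrite inv_letterK eqxx.
case: ifPn => [/eqP ll'|_] /=; last by rewrite inv_letterK eqxx.
subst l'; case: w rw => [|l'' w] //=.
by rewrite /reduced /= => /andP[/negPf ->].
Qed.

Lemma reduced_foldr u v : reduced v -> reduced (foldr push v u).
Proof. by move=> rv; elim: u => //= l u; exact: reduced_push. Qed.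

Lemma foldr_push l v w : reduced w ->
  foldr push w (push l v) = push l (foldr push w v).
Proof.
case: v => [//|l' v] rw /=; case: eqP => [->|//].
have := pushK (inv_letter l) (reduced_foldr v rw).
by rewrite inv_letterK => ->.
Qed.

Lemma foldr_nil w : reduced w -> foldr push [::] w = w.
Proof.
elim: w => //= l w IHw rlw; rewrite IHw; last exact: reduced_cons rlw.
by case: w rlw {IHw} => //= l' w; rewrite /reduced /= => /andP[/negPf ->].
Qed.

Definition free_mul (x y : free_group) : free_group :=
  FreeGroup (@reduced_foldr (word x) (word y) (valP y)).
Definition free_one : free_group := @FreeGroup [::] isT.

(* The inverse word is the reversed word with every letter inverted; it is
   reduced already, and is pushed onto the empty word only so that this need
   not be checked. *)
Definition free_inv (x : free_group) : free_group :=
  FreeGroup (@reduced_foldr (rev (map inv_letter (word x))) [::] isT).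

Lemma free_mulA : associative free_mul.
Proof.
move=> x y z; apply: val_inj => /=; have rz := valP z.
elim: (word x) => //= l u ->.
by rewrite foldr_push.
Qed.

Lemma free_1mul : left_id free_one free_mul.
Proof. by move=> x; exact: val_inj. Qed.

Lemma free_mul1 : right_id free_one free_mul.
Proof. by move=> x; apply: val_inj => /=; rewrite foldr_nil //; exact: valP. Qed.

Lemma foldr_foldr u v w : reduced w ->
  foldr push w (foldr push v u) = foldr push (foldr push w v) u.
Proof.
move=> rw; elim: u => //= l u <-.
by rewrite foldr_push.
Qed.

Lemma free_mulV : left_inverse free_one free_inv free_mul.
Proof.
move=> x; apply: val_inj => /=; have := valP x => /= rx.
rewrite foldr_foldr //= -[X in foldr push X _](foldr_nil rx).
elim: (word x) (rx) => //= l w IHw rlw.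
have rw := reduced_cons rlw.
rewrite rev_cons foldr_rcons pushK; last exact: reduced_foldr.
exact: IHw.
Qed.

Lemma free_Vmul : right_inverse free_one free_inv free_mul.
Proof.
move=> x; rewrite -[LHS]free_1mul -(free_mulV (free_inv x)) -free_mulA.
by rewrite (free_mulA (free_inv x)) free_mulV free_1mul.
Qed.

HB.instance Definition _ := isGroup.Build free_group free_mulA free_1mul
  free_mul1 free_mulV free_Vmul.

Definition free_gen (t : T) : free_group := @FreeGroup [:: (t, false)] isT.

End FreeGroup.

Definition is_free (G : groupType) : Prop :=
  exists T : choiceType, group_isomorphic (free_group T) G.

(** ** Free families in the centre *)

Definition expgz (G : groupType) (x : G) (n : int) : G :=
  match n with Posz k => x ^+ k | Negz k => x ^- k.+1 end.

(* [a g], for [g] in [P], are free generators of a free abelian group, i.e.,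
   are linearly independent over the integers. Only used for commuting
   [a g], so that the order of the factors is irrelevant. *)
Definition free_abelian_family (I : eqType) (H : groupType) (P : set I)
    (a : I -> H) : Prop :=
  forall (s : seq I) (n : I -> int), uniq s -> (forall g, g \in s -> P g) ->
    \prod_(g <- s) expgz (a g) (n g) = 1 -> forall g, g \in s -> n g = 0%R.

Lemma generated_central_normal (H : groupType) (A : set H) :
  A `<=` @centre H -> is_normal_subgroup (generated A).
Proof.
move=> Acentral; split; first split.
- by move=> B [[B1 _] _].
- move=> x y gx gy B BA; have [[_ BB] _] := BA.
  by apply: BB; [exact: gx|exact: gy].
move=> x g gx; suff /(_ g) xg : centre x by rewrite /conjg xg mulKg.
apply: gx; split=> //; split=> [y|u v uc vc y].
  by rewrite /commute mul1g mulg1.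
have vy := vc y; rewrite /commute -!mulgA.
have -> : v^-1 * y = y * v^-1.
  by apply: (mulgI v); rewrite mulVKg mulgA vy mulgK.
by rewrite !mulgA (uc y).
Qed.

Definition generated_central (I : Type) (H : groupType) (P : set I)
    (a : I -> H) (a_central : forall g, P g -> centre (a g))
    (S : set I) (SP : S `<=` P) : normal_subgroup H :=
  NormalSubgroup (@generated_central_normal H (a @` S)
    (fun _ '(ex_intro2 g Sg ag) => eq_ind _ (@centre H)
       (a_central g (SP g Sg)) _ ag)).

(** * Countable Borel equivalence relations *)

#[short(type="completeMetricType")]
HB.structure Definition CompleteMetric (R : realType) :=
  {T of Metric R T & Complete T}.

Definition separable_space (T : topologicalType) : Prop :=
  exists2 D : set T, countable D & dense D.

Definition borel_space (T : ptopologicalType) : Type :=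
  g_sigma_algebraType (@open T).
HB.instance Definition _ (T : ptopologicalType) :=
  Measurable.on (borel_space T).

(* [X] is Borel isomorphic to a Polish space; [R] only provides the real
   numbers in which distances take their values. *)
Definition standard_borel (R : realType) d (X : measurableType d) : Prop :=
  exists2 M : completeMetricType R, separable_space M &
  exists2 f : X -> borel_space M, bijective f &
    forall B : set (borel_space M), measurable B <-> measurable (f @^-1` B).

Definition countable_borel_equivalence (R : realType) d (X : measurableType d)
    (E : X -> X -> Prop) : Prop :=
  [/\ standard_borel R X,
      RelationClasses.Equivalence E,
      measurable [set p : X * X | E p.1 p.2] &
      forall x, countable [set y | E x y]].

Definition weakly_borel_reducible d (X : measurableType d)
    d' (Y : measurableType d') (E : X -> X -> Prop) (F : Y -> Y -> Prop)
    : Prop :=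
  exists f : X -> Y,
    [/\ measurable_fun setT f,
        forall y, countable (f @^-1` [set y]) &
        forall x x', E x x' -> F (f x) (f x')].

(* A [measurableType] is nonempty; this loses nothing, since a relation on an
   empty space is trivially reducible. *)
Definition weakly_universal (R : realType) d (X : measurableType d)
    (E : X -> X -> Prop) : Prop :=
  countable_borel_equivalence R E /\
  forall (d' : measure_display) (Y : measurableType d') (F : Y -> Y -> Prop),
    countable_borel_equivalence R F -> weakly_borel_reducible F E.

(** * The space of finitely generated bi-orderable groups *)

Definition Finf : groupType := free_group nat.

(* The subset [S] is identified with its characteristic function. *)
Definition powerset_space : Type := {ptws Finf -> bool}.
HB.instance Definition _ := Topological.on powerset_space.
HB.instance Definition _ := isPointed.Build powerset_space (fun=> true).

Definition Nspace : set powerset_space :=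
  [set N : powerset_space | is_normal_subgroup [set g | N g] /\
           finite_set [set i : nat | ~~ N (free_gen i)]].

Definition BO_set : set powerset_space :=
  [set N : powerset_space | Nspace N /\ exists hN : is_normal_subgroup [set g | N g],
             bi_orderable (quotient (NormalSubgroup hN))].

Definition BO : Type := set_type BO_set.
HB.instance Definition _ := Choice.on BO.

Lemma BO_normal (N : BO) : is_normal_subgroup [set g | val N g].
Proof. by have /set_mem[[]] := valP N. Qed.

Definition BO_group (N : BO) : groupType :=
  quotient (NormalSubgroup (BO_normal N)).

Lemma BO_full : (fun=> true : bool) \in BO_set.
Proof.
have normal_full : is_normal_subgroup [set g : Finf | true] by [].
apply/mem_set; split.
  by split=> //; apply: (@sub_finite_set _ _ set0).
exists normal_full; exists (fun _ _ => False).
split=> [u []|//|u v []|//].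
by rewrite -(coset_repr u) -(coset_repr v); exact/coset_eq.
Qed.

HB.instance Definition _ := isPointed.Build BO
  (exist (fun N => N \in BO_set) (fun=> true) BO_full).

Definition BO_space : Type :=
  g_sigma_algebra_preimageType (val : BO -> borel_space powerset_space).
HB.instance Definition _ := Measurable.on BO_space.

Definition BO_iso (N M : BO_space) : Prop :=
  group_isomorphic (BO_group N) (BO_group M).

(* Main.v *)
From HB Require Import structures.
Require Import Defs.
From mathcomp Require Import all_boot all_order all_algebra.
From mathcomp Require Import all_classical all_reals all_analysis.
From mathcomp Require Import zify.

(** Why the theorem is true.

    Isomorphism is a countable Borel equivalence relation. Two points [N] and
    [M] of the space contain almost all the generators of [Finf], so that an
    isomorphism between the quotients is given by finitely many elements of
    [Finf]; quantifying over the countably many finite lists shows that the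
    relation is Borel and that its classes are countable ([BO_isoP]). The space
    is standard Borel because bi-orderability of the quotient by [N] is the
    existence of a positive cone, which passes to limits by compactness
    ([BO_limit_cone]): the only condition that is not closed is that [N]
    contains almost all the generators, and it becomes closed once the bound
    beyond which they all lie in [N] is recorded ([BO_code_closed]).

    Universality. Let [E] be a countable Borel equivalence relation on [Y]. By
    Feldman and Moore, there are countably many Borel involutions [s n] of [Y]
    such that [E]-related points are exchanged by some [s n]
    ([feldman_moore]); moreover [Y] embeds in the Cantor space by a Borel map
    [e]. Let [t] and [b] be two of the free generators of [F]. The group [F]
    acts on the product of the integers with [Y]: [b] shifts the first
    coordinate, which is called the level, and [t] acts by [s n] on level [n],
    so that the conjugates of [t] by powers of [b] realize all the [s n] on
    level 0. One of [b] and its inverse is positive, say [B]. The set [S y] of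
    all conjugates of [B ^+ i.+1] by those [h] for which the digit [i] of
    [h^-1 (0, y)] is one lies in the positive cone, which is invariant under
    conjugation. If [y] and [y'] are [E]-related, then [S y] and [S y'] are
    conjugate, so that the quotients of [H] by the corresponding central
    subgroups are isomorphic. On the other hand [S y] determines [y]: an
    equality between conjugates of positive powers of [B] forces the exponents
    to be equal and the conjugator to be a power of [b]
    ([conjugate_pow]), which moves the level only. As the [a g] are linearly
    independent, the subgroup that they generate for [g] in [S y] determines
    [S y]. Writing [H] as a quotient of [Finf] and pulling this subgroup back
    gives an injective Borel map from [Y] that sends [E]-related points to
    isomorphic groups.

    The theorem of Feldman and Moore rests on that of Lusin and Novikov: an
    analytic set with countable sections is covered by countably many graphs of
    Borel functions ([lusin_novikov]). The proof is a single step of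
    derivation. Call a finite system of approximations to points of one common
    section small if countably many Borel graphs meet every realization of it.
    There are countably many systems, hence one countable family of Borel
    graphs that serves for all the small ones. If this family does not cover the
    set, then the trivial system is not small, and every system that is not
    small extends to one in which each approximation is split into two: else
    the realizations would form an analytic partial function, which extends to
    a Borel one by the separation theorem ([souslin_separation]). Iterating
    produces a perfect set in one section. *)

Set Implicit Arguments.
Unset Strict Implicit.
Unset Printing Implicit Defensive.

Import Order.TTheory GRing.Theory Num.Theory.

Local Open Scope classical_set_scope.

(** * Analytic sets and separation *)

Section Souslin.
Variables (X D : Type) (d : nat -> X -> D).

Definition agree n (x x' : X) := forall i, (i < n)%N -> d i x = d i x'.

Definition eq_upto (T : Type) n (w w' : nat -> T) :=
  forall i, (i < n)%N -> w i = w' i.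

(** Closedness in the product of [X] with the Baire space, for the topology on
    [X] that the digits generate. *)
Definition digit_closed (C : X -> (nat -> nat) -> Prop) := forall x w,
  (forall n, exists x' w', [/\ agree n x x', eq_upto n w w' & C x' w']) ->
  C x w.

(** The projections of closed sets along the Baire space, that is, the analytic
    sets when the digits identify [X] with a space of sequences. *)
Definition souslin (A : set X) := exists2 C : X -> (nat -> nat) -> Prop,
  digit_closed C & forall x, A x <-> exists w, C x w.

(** These sets form a sigma-algebra, which is how Borel sets are seen to be
    analytic. *)
Definition bisouslin (A : set X) := souslin A /\ souslin (~` A).

Lemma souslin_digit i (Q : set D) : souslin [set x | Q (d i x)].
Proof.
exists (fun x _ => Q (d i x)) => [x w /(_ i.+1)|x /=].
  by case=> x' [w' [xx' _]]; rewrite xx'.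
by split=> [|[]//]; exists (fun=> 0%N).
Qed.

Lemma bisouslin_digit i (Q : set D) : bisouslin [set x | Q (d i x)].
Proof. by split; [exact: souslin_digit|exact: (souslin_digit i (~` Q))]. Qed.

(** The first entry of a witness chooses one of the sets; the rest is a witness
    for that set. *)
Lemma souslin_bigcup (A : nat -> set X) :
  (forall k, souslin (A k)) -> souslin (\bigcup_k A k).
Proof.
move=> /(_ _)/cid2-/all_sig2[C Ccl CA].
exists (fun x w => C (w 0%N) x (fun i => w i.+1)) => [x w xw|x].
  apply: Ccl => n; have [x' [w' [xx' ww' Cx'w']]] := xw n.+1.
  exists x', (fun i => w' i.+1); split=> [i /ltnW|i ?|]; first exact: xx'.
    by rewrite ww'.
  by rewrite ww'.
split=> [[k _ /CA[w xw]]|[w xw]].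
  by exists (fun i => if i is i.+1 then w i else k).
by exists (w 0%N) => //; apply/CA; exists (fun i => w i.+1).
Qed.

(** One sequence interleaves witnesses for all the sets. *)
Lemma souslin_bigcap (A : nat -> set X) :
  (forall k, souslin (A k)) -> souslin (\bigcap_k A k).
Proof.
move=> /(_ _)/cid2-/all_sig2[C Ccl CA].
exists (fun x w => forall k, C k x (fun i => w (pickle (k, i)))) =>
  [x w xw k|x].
  apply: Ccl => n.
  have [x' [w' [xx' ww' Cx'w']]] :=
    xw (maxn n (\max_(i < n) (pickle (k, i : nat)).+1)).
  exists x', (fun i => w' (pickle (k, i))); split=> [i lin|i lin|//].
    by apply: xx'; rewrite (leq_trans lin) ?leq_maxl.
  apply: ww'; rewrite leq_max; apply/orP; right.
  exact: (leq_bigmax (F := fun i : 'I_n =>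
    (pickle (k, i : nat)).+1) (Ordinal lin)).
split=> [xA|[w xw] k _]; last by apply/CA; exists (fun i => w (pickle (k, i))).
have /choice[w xw] k : exists w, C k x w by apply/CA/xA.
exists (fun m => if @unpickle (nat * nat)%type m is Some (k,
  i) then w k i else 0%N).
move=> k; rewrite [X in C k x X](_ : _ = w k) //.
by apply/funext => i; rewrite pickleK.
Qed.

Lemma bisouslinC A : bisouslin A -> bisouslin (~` A).
Proof. by case=> sA scA; split; rewrite ?setCK. Qed.

Lemma bisouslin_bigcup (A : nat -> set X) :
  (forall k, bisouslin (A k)) -> bisouslin (\bigcup_k A k).
Proof.
move=> sA; split; first by apply: souslin_bigcup => k; case: (sA k).
by rewrite setC_bigcup; apply: souslin_bigcap => k; case: (sA k).
Qed.

Lemma bisouslin0 : bisouslin set0.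
Proof.
split; [exists (fun _ _ => False)|exists (fun _ _ => True)] => //.
- by move=> x w /(_ 0%N)[x' [w' []]].
- by move=> x; split=> // -[].
- by move=> x; split=> [_|_ []]; exists (fun=> 0%N).
Qed.

Lemma bisouslin_preimage (Z : Type) (g : X -> Z) (G : set (set Z)) :
  (forall A, G A -> bisouslin (g @^-1` A)) ->
  forall A, <<s G >> A -> bisouslin (g @^-1` A).
Proof.
move=> sG; suff sub : <<s G >> `<=` [set A | bisouslin (g @^-1` A)].
  by move=> A /sub.
apply: smallest_sub => //; split => /=.
- by rewrite preimage_set0; exact: bisouslin0.
- by move=> B sB; rewrite setTD preimage_setC; exact: bisouslinC.
- by move=> B sB; rewrite preimage_bigcup; exact: bisouslin_bigcup.
Qed.

Lemma souslinI A B : souslin A -> souslin B -> souslin (A `&` B).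
Proof.
move=> sA sB.
suff -> : A `&` B = \bigcap_k (if k is 0%N then A else B).
  by apply: souslin_bigcap => -[].
apply/seteqP; split=> x; first by case=> Ax Bx [].
by move=> ABx; split; [exact: (ABx 0%N)|exact: (ABx 1%N)].
Qed.

End Souslin.

Definition cantor := nat -> bool.

Definition digit (i : nat) (x : cantor) := x i.
Definition digit2 (i : nat) (p : cantor * cantor) := (p.1 i, p.2 i).

Definition cylinders : set (set cantor) :=
  [set A | exists i, A = [set x : cantor | x i]].

Definition cantor_borel : set (set cantor) := <<s cylinders >>.

Definition borel_map (f : cantor -> cantor) :=
  forall i, cantor_borel [set x | f x i].

(** The parities of the even entries of a witness store the point [y]. *)
Lemma souslin_proj (A : set (cantor * cantor)) :
  souslin digit2 A -> souslin digit [set x | exists y, A (x, y)].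
Proof.
case=> C Ccl CA.
exists (fun x w => C (x, fun i => odd (w i.*2)) (fun i => w i.*2.+1)).
  move=> x w xw; apply: Ccl => n; have [x' [w' [xx' ww' Cx'w']]] := xw n.*2.
  exists (x', fun i => odd (w' i.*2)), (fun i => w' i.*2.+1); split=> // i lin.
    have xi : x i = x' i by apply: xx'; rewrite -addnn ltn_addr.
    by rewrite /digit2 /= xi ww' ?ltn_double.
  by apply: ww'; rewrite -doubleS leq_double.
move=> x; split=> [[y /CA[w xw]]|[w xw]]; last first.
  by exists (fun i => odd (w i.*2)); apply/CA; eexists; exact: xw.
exists (fun i => if odd i then w i./2 else y i./2).
have -> : (fun i => odd (if odd i.*2 then w i.*2./2 else y i.*2./2)) = y.
  by apply/funext => i; rewrite odd_double doubleK; case: (y i).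
suff -> : (fun i => if odd i.*2.+1 then w i.*2.+1./2 else y i.*2.+1./2 : nat) =
  w.
  by [].
by apply/funext => i; rewrite /= odd_double /= uphalf_double.
Qed.

Lemma borelC A : cantor_borel A -> cantor_borel (~` A).
Proof. exact: sigma_algebraC. Qed.

Lemma borel_bigcup (A : nat -> set cantor) :
  (forall k, cantor_borel (A k)) -> cantor_borel (\bigcup_k A k).
Proof. exact: sigma_algebra_bigcup. Qed.

Lemma borel_bigcap (A : nat -> set cantor) :
  (forall k, cantor_borel (A k)) -> cantor_borel (\bigcap_k A k).
Proof.
move=> bA; rewrite -[\bigcap_k _]setCK setC_bigcap; apply: borelC.
by apply: borel_bigcup => k; exact: borelC.
Qed.

Lemma borelI A B : cantor_borel A -> cantor_borel B -> cantor_borel (A `&` B).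
Proof.
move=> sA sB.
suff -> : A `&` B = \bigcap_k (if k is 0%N then A else B).
  by apply: borel_bigcap => -[].
apply/seteqP; split=> x; first by case=> Ax Bx [].
by move=> ABx; split; [exact: (ABx 0%N)|exact: (ABx 1%N)].
Qed.

Lemma borelU A B : cantor_borel A -> cantor_borel B -> cantor_borel (A `|` B).
Proof.
move=> sA sB; rewrite -[A `|` B]setCK setCU; apply: borelC.
by apply: borelI; exact: borelC.
Qed.

Lemma borel_digit i b : cantor_borel [set x | x i = b].
Proof.
have bi : cantor_borel [set x | x i] by apply: sub_gen_smallest; exists i.
case: b => //; suff -> : [set x : cantor | x i = false] = ~` [set x | x i].
  exact: borelC.
by apply/seteqP; split=> x /= => [->//|/negP/negbTE].
Qed.

Lemma borel0 : cantor_borel set0.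
Proof. exact: sigma_algebra0. Qed.

(** Dependent choice along finite sequences: an infinite branch through a tree
    without dead ends. *)
Lemma dependent_digits (D : Type) (Q : seq D -> Prop) :
  Q [::] -> (forall s, Q s -> exists x, Q (rcons s x)) ->
  exists f : nat -> D, forall n, Q (mkseq f n).
Proof.
move=> Q0 QS.
have /choice[g gP] : forall s : {s | Q s}, exists x, Q (rcons (sval s) x).
  by case=> s Qs; exact: QS.
pose next s : {s | Q s} := exist _ _ (gP s).
pose st n := iter n next (exist _ _ Q0).
exists (fun n => g (st n)) => n.
suff -> : mkseq (fun n => g (st n)) n = sval (st n) by exact: (svalP (st n)).
elim: n => // n IHn; rewrite -addn1 /mkseq iotaD map_cat -/(mkseq _ _) IHn addn1
  /=.
by rewrite cats1.
Qed.

Definition separated (A B : set cantor) :=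
  exists2 S, cantor_borel S & A `<=` S /\ B `<=` ~` S.

Lemma separated0l B : separated set0 B.
Proof. by exists set0; [exact: borel0|split=> [x []|x _ []]]. Qed.

Lemma separated0r A : separated A set0.
Proof.
by exists (~` set0); [exact: borelC borel0|split=> x // _ []].
Qed.

(** By contraposition, a failure of separation passes to a pair of pieces. *)
Lemma separated_bigcup (A B : nat -> set cantor) :
  (forall k l, separated (A k) (B l)) ->
  separated (\bigcup_k A k) (\bigcup_l B l).
Proof.
move=> sAB; pose S k l := s2val (cid2 (sAB k l)).
have SP k l : cantor_borel (S k l) /\ A k `<=` S k l /\ B l `<=` ~` S k l.
  by rewrite /S; case: cid2.
exists (\bigcup_k \bigcap_l S k l).
  by apply: borel_bigcup => k; apply: borel_bigcap => l; case: (SP k l).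
split=> x [k _].
  by move=> Ax; exists k => // l _; case: (SP k l) => _ [+ _]; exact.
by move=> Bx [l _ /(_ k I)]; case: (SP l k) => _ [_ /(_ x Bx)].
Qed.

Lemma eq_upto_rcons (T : Type) (x0 : T) (s : seq T) (v : nat -> T) :
  eq_upto (size s) (nth x0 s) v ->
  eq_upto (size s).+1 (nth x0 (rcons s (v (size s)))) v.
Proof.
move=> sv i; rewrite ltnS leq_eqVlt nth_rcons.
by case/predU1P=> [->|lis]; [rewrite ltnn eqxx|rewrite lis; exact: sv].
Qed.

(** Lusin's separation theorem. A failure of separation passes to smaller and
    smaller pieces of [A] and [B] that agree on more and more digits; in the
    limit, one point has witnesses for both sets. *)
Lemma souslin_separation (A B : set cantor) :
  souslin digit A -> souslin digit B -> A `&` B = set0 -> separated A B.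
Proof.
case=> C Ccl CA [C' C'cl C'B] AB0; apply: contrapT => nAB.
(* The points with a witness that, together with the digits of the point,
   starts as [s] prescribes. *)
pose piece (E : cantor -> (nat -> nat) -> Prop) (s : seq (nat * bool)) :=
  [set x | exists w, [/\ eq_upto (size s) (nth (0, false) s) (fun i =>
    (w i, x i)) &
     E x w]].
have pieceS E s : piece E s =
    \bigcup_m (if unpickle m is Some kb then piece E (rcons s kb) else set0).
  apply/seteqP; split=> x.
    case=> w [sx Exw]; exists (pickle (w (size s), x (size s))) => //=.
    rewrite pickleK; exists w; rewrite size_rcons; split=> //.
    exact: (eq_upto_rcons sx).
  case=> m _; case: unpickle => // kb [w [sx Exw]]; exists w; split=> // i lis.
  by move: (sx i); rewrite size_rcons nth_rcons lis => -> //; exact: ltnW.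
(* The two pieces share their digits: pieces whose digits differ are separated
   by a cylinder. *)
pose Q (s : seq (nat * nat * bool)) :=
  ~ separated (piece C [seq (u.1.1, u.2) | u <- s])
              (piece C' [seq (u.1.2, u.2) | u <- s]).
have [||f fQ] := @dependent_digits _ Q.
- apply: contra_not nAB => -[S bS [AS BS]]; exists S => //; split=> x.
    by case/CA=> w Cw; apply: AS; exists w.
  by case/C'B=> w Cw; apply: BS; exists w.
- move=> s nQ; apply: contrapT => /forallNP nex; apply: nQ.
  rewrite (pieceS C) (pieceS C'); apply: separated_bigcup => m m'.
  case: (unpickle m) => [[k b]|]; last exact: separated0l.
  case: (unpickle m') => [[l b']|]; last exact: separated0r.
  have [<-|bb'] := eqVneq b b'.
    by have := nex (k, l, b); rewrite /Q !map_rcons => /contrapT.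
  exists [set x | x (size s) = b]; first exact: borel_digit.
  split=> x [w [+ _]] => /(_ (size s));
    rewrite size_rcons size_map nth_rcons size_map ltnn eqxx.
    by move=> /(_ (leqnn _))[].
  by move=> /(_ (leqnn _))[_ b'x] /=; rewrite -b'x => /esym/eqP; exact/negP.
pose x i := (f i).2; pose w i := (f i).1.1; pose w' i := (f i).1.2.
suff ABx : (A `&` B) x by move: ABx; rewrite AB0.
have nonempty n : piece C [seq (u.1.1, u.2) | u <- mkseq f n] !=set0
    /\ piece C' [seq (u.1.2, u.2) | u <- mkseq f n] !=set0.
  split; apply/set0P/negP => /eqP p0; apply: (fQ n); rewrite p0.
    exact: separated0l.
  exact: separated0r.
split.
  apply/CA; exists w; apply: Ccl => n.
  have [[x' [w1 [xw1 Cx']]] _] := nonempty n.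
  exists x', w1; split=> // i lin; move: (xw1 i);
    by rewrite size_map size_mkseq (nth_map (f 0%N)) ?size_mkseq ?nth_mkseq //
      => /(_ lin)[].
apply/C'B; exists w'; apply: C'cl => n.
have [_ [x' [w1 [xw1 Cx']]]] := nonempty n.
exists x', w1; split=> // i lin; move: (xw1 i);
  by rewrite size_map size_mkseq (nth_map (f 0%N)) ?size_mkseq ?nth_mkseq // =>
    /(_ lin)[].
Qed.

(** * Analytic sets with countable sections *)

Lemma souslin_forall_mem (X D : Type) (d : nat -> X -> D) (T : eqType)
    (s : seq T) (W : T -> set X) : (forall t, souslin d (W t)) ->
  souslin d [set x | forall t, t \in s -> W t x].
Proof.
move=> sW; elim: s => [|t s IHs].
  rewrite (_ : mkset _ = ~` set0); last by apply/seteqP; split=> [x _ []|x _ t].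
  by case: (bisouslinC (bisouslin0 d)).
rewrite (_ : mkset _ = W t `&` [set x | forall t, t \in s -> W t x]).
  exact: souslinI.
apply/seteqP; split=> x => [xW|[Wtx xW] u].
  split=> [|u us]; first by apply: xW; rewrite mem_head.
  by apply: xW; rewrite inE us orbT.
by rewrite inE => /predU1P[->//|]; exact: xW.
Qed.

Lemma souslin_graphC (f : cantor -> cantor) : borel_map f ->
  souslin digit2 [set p | p.2 <> f p.1].
Proof.
(* [m] codes an index [m./2] at which the two points differ and the digit
   [odd m] of the second one there. *)
move=> bf; rewrite (_ : mkset _ = \bigcup_m
   ([set p | p.2 m./2 = odd m] `&` [set p | f p.1 m./2 <> odd m])).
  apply: souslin_bigcup => m; apply: souslinI.
    exact: (@souslin_digit _ _ digit2 m./2 [set b | b.2 = odd m]).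
  have bfm : cantor_borel [set x | f x m./2 <> odd m].
    case: (odd m); last first.
      rewrite (_ : mkset _ = [set x | f x m./2]); first exact: bf.
      by apply/seteqP; split=> x /=; case: (f x _).
    rewrite (_ : mkset _ = ~` [set x | f x m./2]); first exact: borelC (bf _).
    by apply/seteqP; split=> x /=; case: (f x _).
  have cyl A : cylinders A -> bisouslin digit2 (fst @^-1` A).
    case=> i ->; exact (@bisouslin_digit _ _ digit2 i [set b : bool * bool |
      b.1]).
  exact: (bisouslin_preimage cyl bfm).1.
apply/seteqP; split=> -[x y] /= => [yfx|[m _ [/= ym]] fm yfx]; last first.
  by apply: fm; rewrite -yfx.
suff [i yi] : exists i, y i <> f x i.
  exists (y i + i.*2)%N => //=; split=> /=;
    by rewrite half_bit_double oddD odd_double addbF oddb // => /esym.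
by apply: contrapT => /forallNP eqyf; apply: yfx; apply/funext => i;
  exact: contrapT.
Qed.

Lemma borel_map_false : borel_map (fun _ _ => false).
Proof.
move=> i; rewrite (_ : mkset _ = set0); first exact: borel0.
by apply/seteqP; split.
Qed.

Lemma no_injection_cantor (g : cantor -> nat) : ~ injective g.
Proof.
move=> ginj; pose b : cantor := fun n =>
  `[< exists2 c, g c = n & c n = false >].
have := erefl (b (g b)); rewrite {1}/b; case bb: (b (g b)); first last.
  by move/asboolPn; apply; exists b.
by move=> /asboolP[c /ginj -> cb]; rewrite cb in bb.
Qed.

(** A sequence of approximations, each correct on an initial segment for the
    following one, agrees with its diagonal on these segments. *)
Lemma limit_stable (T : Type) (n : nat -> nat) (s : nat -> nat -> T) :
  (forall k, k <= n k)%N -> (forall k, n k <= n k.+1)%N ->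
  (forall k, eq_upto (n k) (s k) (s k.+1)) ->
  forall k, eq_upto (n k) (s k) (fun i => s i.+1 i).
Proof.
move=> nk nS sS.
have nD k l : (n k <= n (k + l))%N.
  by elim: l => [|l IHl]; rewrite ?addn0 // addnS (leq_trans IHl).
have sD k l : eq_upto (n k) (s k) (s (k + l)%N).
  elim: l => [|l IHl] i ink; first by rewrite addn0.
  by rewrite IHl // addnS -sS // (leq_trans ink).
move=> k i ink; by rewrite (sD k i.+1) // (sD i.+1 k) ?(addnC k).
Qed.

Section LusinNovikov.
Variables (C : cantor * cantor -> (nat -> nat) -> Prop).
Hypothesis C_closed : digit_closed digit2 C.

(** An approximation to a point [y] of a section and to a witness for it. *)
Definition node := (seq bool * seq nat)%type.
(** A depth, an approximation to a point [x] at that depth, and approximations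
    to several points of the section over [x]. *)
Definition config := (nat * seq bool * seq node)%type.

Implicit Types (t : node) (g : config) (f : nat -> cantor -> cantor).

Definition depth g := g.1.1.
Definition stem g := g.1.2.
Definition nodes g := g.2.

Definition avoids f (p : cantor * cantor) := forall k, p.2 <> f k p.1.

Definition meets n t (p : cantor * cantor) := exists w,
  [/\ eq_upto n (nth false t.1) p.2, eq_upto n (nth 0 t.2) w & C p w].

Definition realizes f g x := eq_upto (depth g) (nth false (stem g)) x /\
  forall t, t \in nodes g -> exists y,
    meets (depth g) t (x, y) /\ avoids f (x, y).

Definition borel_seq f := forall k, borel_map (f k).

Definition small g := exists2 f, borel_seq f & forall x, ~ realizes f g x.

(** The families that witness smallness of the countably many configurations
    merge into one. *)
Lemma universal_family : exists2 f, borel_seq f &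
  forall g, small g -> forall x, ~ realizes f g x.
Proof.
have /choice[F FP] g : exists f, borel_seq f /\
    (small g -> forall x, ~ realizes f g x).
  have [[f bf fg]|ns] := pselect (small g); first by exists f.
  by exists (fun _ _ _ => false); split=> // k; exact: borel_map_false.
pose f k := if @unpickle (config * nat)%type k is Some (g, m) then F g m
            else fun _ _ => false.
exists f => [k|g /(FP g).2 nreal x [xg real]].
  rewrite /f; case: unpickle => [[g m]|i]; last exact: borel_map_false.
  exact: (FP g).1.
apply: (nreal x); split=> // t /real[y [ty fy]]; exists y; split=> // m.
by move: (fy (pickle (g, m))); rewrite /f pickleK.
Qed.

Definition extends n t t' :=
  eq_upto n (nth false t.1) (nth false t'.1) /\ eq_upto n (nth 0 t.2)
    (nth 0 t'.2).

Definition differ n t t' :=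
  exists2 i, (i < n)%N & nth false t.1 i <> nth false t'.1 i.

Lemma extends_trans n n' t t' t'' : (n <= n')%N ->
  extends n t t' -> extends n' t' t'' -> extends n t t''.
Proof.
move=> nn' [y w] [y' w']; split=> i lin.
  by rewrite y // y' // (leq_trans lin).
by rewrite w // w' // (leq_trans lin).
Qed.

Lemma differ_extends n n' t u t' u' : (n <= n')%N ->
  differ n t u -> extends n t t' -> extends n u u' -> differ n' t' u'.
Proof.
move=> nn' [i lin tu] [tt' _] [uu' _]; exists i; first exact: leq_trans nn'.
by rewrite -tt' // -uu'.
Qed.

Lemma souslin_meets n t : souslin digit2 (meets n t).
Proof.
exists (fun p w => [/\ eq_upto n (nth false t.1) p.2,
  eq_upto n (nth 0 t.2) w & C p w]) => //.
move=> p w pw; have [p' [w' [pp' ww' [tp' tw' Cp']]]] := pw n.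
split=> [i lin|i lin|]; first by rewrite tp' //; have [] := pp' i lin.
  by rewrite tw' // ww'.
apply: C_closed => m; have [p1 [w1 [pp1 ww1 [_ _ C1]]]] := pw m.
by exists p1, w1.
Qed.

Variable f : nat -> cantor -> cantor.
Hypothesis f_borel : borel_seq f.
Hypothesis f_universal : forall g, small g -> forall x, ~ realizes f g x.

Definition live g := exists x, realizes f g x.

Lemma souslin_avoids : souslin digit2 (avoids f).
Proof.
rewrite (_ : avoids f = \bigcap_k [set p | p.2 <> f k p.1]).
  by apply: souslin_bigcap => k; exact: souslin_graphC.
by apply/seteqP; split=> p fp k; [move=> _|]; exact: fp.
Qed.

Lemma souslin_realizes g : souslin digit (realizes f g).
Proof.
rewrite (_ : realizes f g =
  [set x | forall i, i \in iota 0 (depth g) -> nth false (stem g) i = x i] `&`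
  [set x | forall t, t \in nodes g ->
     exists y, meets (depth g) t (x, y) /\ avoids f (x, y)]).
  apply: souslinI; apply: souslin_forall_mem.
    by move=> i; exact: (@souslin_digit _ _ digit i [set b |
      nth false (stem g) i = b]).
  move=> t; apply: (@souslin_proj (meets (depth g) t `&` avoids f)).
  by apply: souslinI; [exact: souslin_meets|exact: souslin_avoids].
apply/seteqP; split=> x [xg real]; split=> // i lin; apply: xg.
  by rewrite mem_iota in lin.
by rewrite mem_iota.
Qed.

(** Otherwise the points that realize node [j] form the graph of a function of
    [x]. This graph is analytic; separating, for each digit, the [x] where that
    digit of the value is one from those where it is zero extends the function
    to a Borel one. Adding the extension to [f] shows that [g] is small, which
    contradicts the choice of [f]. *)
Lemma live_split_pair g j : live g -> (j < size (nodes g))%N ->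
  exists x y y', [/\ realizes f g x, y <> y',
    meets (depth g) (nth ([::], [::]) (nodes g) j) (x, y), avoids f (x, y) &
    meets (depth g) (nth ([::], [::]) (nodes g) j) (x, y') /\ avoids f (x, y')].
Proof.
move=> [x0 gx0] jg; set t := nth _ _ _; apply: contrapT => nex.
pose D i b := [set x | realizes f g x /\
  exists y, [/\ meets (depth g) t (x, y), avoids f (x, y) & y i = b]].
have sD i b : souslin digit (D i b).
  rewrite (_ : D i b = realizes f g `&` [set x | exists y,
    (meets (depth g) t `&`
    avoids f `&` [set p | p.2 i = b]) (x, y)]); last first.
    by apply/seteqP; split=> x [gx [y]]; [case|move=> [[]]]; split=> //;
      exists y.
  apply: souslinI; first exact: souslin_realizes.
  apply: souslin_proj; apply: souslinI.
    by apply: souslinI; [exact: souslin_meets|exact: souslin_avoids].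
  exact: (@souslin_digit _ _ digit2 i [set c | c.2 = b]).
have /choice[S SP] i : exists S, [/\ cantor_borel S,
  D i true `<=` S & D i false `<=` ~` S].
  have [|S bS [S1 S2]] := souslin_separation (sD i true) (sD i false);
    last by exists S.
  apply/seteqP; split=> // x [[gx [y [ty fy yi]]] [_ [y' [ty' fy' y'i]]]].
  apply: nex; exists x, y, y'; split=> // yy'.
  by move: y'i; rewrite -yy' yi.
pose h : cantor -> cantor := fun x i => `[< S i x >].
have bh : borel_map h.
  move=> i; have [bS _ _] := SP i; rewrite (_ : mkset _ = S i) //.
  by apply/seteqP; split=> x /asboolP.
apply: (@f_universal g) gx0.
exists (fun k => if k is k.+1 then f k else h) => [[|k]//|x [xg real]].
have real' : realizes f g x.
  by split=> // u /real[y [uy hy]]; exists y; split=> // k; exact: (hy k.+1).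
have [|y [ty hy]] := real t; first exact: mem_nth.
apply: (hy 0%N) => /=; apply/funext => i.
have fy : avoids f (x, y) by move=> k; exact: (hy k.+1).
have [_ S1 S2] := SP i; apply/esym; case yi: (y i).
  by apply/asboolP/S1; split=> //; exists y.
by apply/asboolP/S2; split=> //; exists y.
Qed.

Local Notation nd g i := (nth ([::], [::]) (nodes g) i).

Lemma split_node g j : live g -> (j < size (nodes g))%N -> exists g',
  [/\ live g', (depth g < depth g')%N,
      eq_upto (depth g) (nth false (stem g)) (nth false (stem g')),
      size (nodes g') = (size (nodes g)).+1 &
   [/\ forall i, (i < size (nodes g))%N -> extends (depth g) (nd g i) (nd g' i),
      extends (depth g) (nd g j) (nd g' (size (nodes g))) &
      differ (depth g') (nd g' j) (nd g' (size (nodes g)))]].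
Proof.
move=> lg jg; have [x [y [y' [[xg real] yy' ty fy [ty' fy']]]]] :=
  live_split_pair lg jg.
(* the new depth must reach a digit where [y] and [y'] differ *)
have [i0 yi0] : exists i, y i <> y' i.
  by apply: contrapT => /forallNP eqy; apply: yy'; apply/funext => i;
    exact: contrapT.
set m := size (nodes g); set n := depth g in xg real ty ty' *.
have /choice[q qP] i : exists q : cantor * (nat -> nat), (i < m)%N ->
   [/\ eq_upto n (nth false (nd g i).1) q.1, eq_upto n (nth 0 (nd g i).2) q.2,
       C (x, q.1) q.2, avoids f (x, q.1) & i = j -> q.1 = y].
  have [->|/eqP ij] := eqVneq i j; first by have [w []] := ty; exists (y, w).
  have [lim|//] := ltnP i m; last by exists (y, fun=> 0).
  have [|z [[w [? ? ?]] ?]] := real (nd g i); first exact: mem_nth.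
  by exists (z, w).
have [w' [y'g w'g Cy']] := ty'.
pose N := (n + i0.+1)%N.
pose code (p : cantor * (nat -> nat)) : node := (mkseq p.1 N, mkseq p.2 N).
pose L := rcons (mkseq (fun i => code (q i)) m) (code (y', w')).
have nthL i : (i < m)%N -> nth ([::], [::]) L i = code (q i).
  by move=> lim; rewrite nth_rcons size_mkseq lim nth_mkseq.
have nthLm : nth ([::], [::]) L m = code (y', w').
  by rewrite nth_rcons size_mkseq ltnn eqxx.
have nN i : (i < n)%N -> (i < N)%N by move=> lin; rewrite ltn_addr.
have i0N : (i0 < N)%N by rewrite /N addnS ltnS leq_addl.
exists (N, mkseq x N, L); rewrite /nodes /stem /depth /=.
split.
- exists x; split=> [i liN|t]; first by rewrite nth_mkseq.
  rewrite /nodes /= mem_rcons inE => /predU1P[->|/mapP[i]].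
    by exists y'; split=> //; exists w'; split=> // i liN; rewrite nth_mkseq.
  rewrite mem_iota => /= lim ->; have [_ _ Cq fq _] := qP i lim.
  by exists (q i).1; split=> //; exists (q i).2; split=> // k liN;
    rewrite nth_mkseq.
- by rewrite /N addnS ltnS leq_addr.
- by move=> i lin; rewrite nth_mkseq ?nN // xg.
- by rewrite size_rcons size_mkseq.
split.
- move=> i lim; rewrite nthL //; have [yq wq _ _ _] := qP i lim.
  by split=> k lkn; rewrite nth_mkseq ?nN //; [exact: yq|exact: wq].
- by rewrite nthLm; split=> k lkn; rewrite nth_mkseq ?nN //;
    [exact: y'g|exact: w'g].
- rewrite nthLm nthL //; exists i0 => //; rewrite !nth_mkseq //=.
  by have [_ _ _ _ ->] := qP j jg.
Qed.

(** The nodes are split one after the other, so that the result still has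
    realizations over a single point. *)
Lemma double_nodes g : live g -> (0 < size (nodes g))%N -> exists g',
  [/\ live g', (depth g < depth g')%N,
      eq_upto (depth g) (nth false (stem g)) (nth false (stem g')),
      size (nodes g') = (size (nodes g)).*2 &
   forall i, (i < size (nodes g))%N ->
   [/\ extends (depth g) (nd g i) (nd g' i),
      extends (depth g) (nd g i) (nd g' (size (nodes g) + i)) &
      differ (depth g') (nd g' i) (nd g' (size (nodes g) + i))]].
Proof.
move=> lg; set m := size (nodes g) => m0.
suff /(_ m (leqnn m))[g' [lg' gg' sg' nd' [ext1 ext2]]] : forall k,
  (k <= m)%N -> exists g',
  [/\ live g', (depth g + k <= depth g')%N,
      eq_upto (depth g) (nth false (stem g)) (nth false (stem g')),
      size (nodes g') = (m + k)%N &
   (forall i, (i < m)%N -> extends (depth g) (nd g i) (nd g' i)) /\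
   forall i, (i < k)%N ->
   extends (depth g) (nd g i) (nd g' (m + i)) /\
   differ (depth g') (nd g' i) (nd g' (m + i))].
  exists g'; split=> //; first by rewrite (leq_trans _ gg') // -addn1 leq_add2l.
    by rewrite nd' addnn.
  by move=> i lim; have [? ?] := ext2 i lim; split=> //; exact: ext1.
elim=> [|k IHk] lkm; first by exists g; split; rewrite ?addn0 //; split.
have [g1 [lg1 gg1 sg1 nd1 [ext1 ext2]]] := IHk (ltnW lkm).
have kg1 : (k < size (nodes g1))%N by rewrite nd1 ltn_addr.
have [g2 [lg2 gg2 sg2 nd2 [ext3 ext4 diff]]] := split_node lg1 kg1.
have gg1' : (depth g <= depth g1)%N by apply: leq_trans gg1; rewrite leq_addr.
exists g2; split=> //.
- by rewrite addnS (leq_ltn_trans gg1).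
- by move=> i lig; rewrite sg1 // sg2 // (leq_trans lig).
- by rewrite nd2 nd1 addnS.
split=> [i lim|i]; first by apply: extends_trans (ext1 i lim) (ext3 _ _) => //;
  rewrite nd1 ltn_addr.
rewrite nd1 in ext3 ext4 diff.
rewrite ltnS leq_eqVlt => /predU1P[->|lik].
  by split=> //; apply: extends_trans (ext1 k lkm) ext4.
have [e2 d2] := ext2 i lik; split.
  by apply: extends_trans e2 (ext3 _ _) => //; rewrite ltn_add2l.
apply: differ_extends (ltnW gg2) d2 (ext3 _ _) (ext3 _ _);
  last by rewrite ltn_add2l.
by rewrite ltn_addr // (ltn_trans lik).
Qed.

(** All the nodes of all the configurations in an iteration of [double_nodes]
    lie over the same [x], and different branches have different limits. *)
Lemma perfect_section : live (0%N, [::], [:: ([::], [::])]) ->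
  exists x (y : cantor -> cantor), injective y /\
    forall b, exists w, C (x, y b) w.
Proof.
move=> live0; pose good g := live g /\ (0 < size (nodes g))%N.
pose root : sig good := exist good _ (conj live0 isT).
have /choice[nxt nxtP] : forall u : sig good, exists u' : sig good,
  let g := sval u in let g' := sval u' in
  [/\ (depth g < depth g')%N,
      eq_upto (depth g) (nth false (stem g)) (nth false (stem g')),
      size (nodes g') = (size (nodes g)).*2 &
   forall i, (i < size (nodes g))%N ->
   [/\ extends (depth g) (nd g i) (nd g' i),
      extends (depth g) (nd g i) (nd g' (size (nodes g) + i)) &
      differ (depth g') (nd g' i) (nd g' (size (nodes g) + i))]].
  move=> [g [lg g0]]; have [g' [lg' dg' sg' nd' ext]] := double_nodes lg g0.
  have g'0 : (0 < size (nodes g'))%N by rewrite nd' double_gt0.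
  by exists (exist good _ (conj lg' g'0)).
pose G k := sval (iter k nxt root).
have GP k := nxtP (iter k nxt root).
have Glive k : live (G k) by have [] := svalP (iter k nxt root).
have Gsize k : size (nodes (G k)) = (2 ^ k)%N.
  by elim: k => // k IHk; have [_ _ + _] := GP k;
    rewrite -/(G k) -/(G k.+1) IHk expnS mul2n.
pose n k := depth (G k).
have nS k : (n k < n k.+1)%N by have [] := GP k.
have nk k : (k <= n k)%N by elim: k => // k IHk; exact: leq_ltn_trans (nS k).
have nSW k := ltnW (nS k).
(* Node [i] of level [k] has children [i] and [2 ^ k + i], so that a branch
   [b] passes at level [k] through the node with binary digits [b]. *)
pose idx (b : cantor) := fix idx k :=
  if k is k.+1 then (if b k then 2 ^ k + idx k else idx k)%N else 0%N.
have idx_lt b k : (idx b k < 2 ^ k)%N.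
  elim: k => //= k IHk; rewrite expnS mul2n -addnn.
  by case: (b k); rewrite ?ltn_add2l // ltn_addr.
pose br b k := nd (G k) (idx b k).
have brS b k : extends (n k) (br b k) (br b k.+1).
  have [_ _ _ /(_ (idx b k))] := GP k;
    rewrite -/(G k) -/(G k.+1) Gsize => /(_ (idx_lt b k)).
  by rewrite /br /=; case: (b k) => -[].
have xP := @limit_stable _ n (fun k => nth false (stem (G k))) nk nSW.
have {}xP k := xP (fun k => let: And4 _ h _ _ := GP k in h) k.
set x : cantor := (fun i => _) in xP.
pose y b : cantor := fun i => nth false (br b i.+1).1 i.
pose w b : nat -> nat := fun i => nth 0 (br b i.+1).2 i.
have yP b k : eq_upto (n k) (nth false (br b k).1) (y b).
  exact: (@limit_stable _ n (fun k => nth false (br b k).1) nk nSW (fun k =>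
    (brS b k).1)).
have wP b k : eq_upto (n k) (nth 0 (br b k).2) (w b).
  exact: (@limit_stable _ n (fun k => nth 0 (br b k).2) nk nSW (fun k =>
    (brS b k).2)).
exists x, y; split=> [b b' yb|b]; last first.
  exists (w b); apply: C_closed => m; have [x' [x'g real]] := Glive m.
  have [|y' [[w' [y'g w'g Cy']] _]] := real (br b m).
    by apply: mem_nth; rewrite Gsize.
  exists (x', y'), w'; split=> // i lim; have lin := leq_trans lim (nk m).
    by rewrite /digit2 /= -(xP m) // x'g // -(yP b m) // y'g.
  by rewrite -(wP b m) // w'g.
apply: contrapT => bb'.
have [k [bk kmin]] : exists k, b k != b' k /\ forall i, (i < k)%N -> b i = b' i.
  have ex : exists k, b k != b' k.
    by apply: contrapT => /forallNP eqb; apply: bb'; apply/funext => k;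
      have /negP/negPn/eqP := eqb k.
  exists (ex_minn ex); case: ex_minnP => k bk kmin; split=> // i lik.
  by apply/eqP/negPn/negP => /kmin; rewrite leqNgt lik.
have idxk : idx b k = idx b' k.
  elim: k kmin {bk} => //= k IHk kmin; rewrite kmin // IHk // => i lik.
  by apply: kmin; rewrite ltnW.
have : differ (n k.+1) (br b k.+1) (br b' k.+1).
  have [_ _ _ /(_ (idx b k))] := GP k;
    rewrite -/(G k) -/(G k.+1) Gsize => /(_ (idx_lt b k))[_ _ diff].
  rewrite /br /= -idxk; move: bk; case: (b k); case: (b' k) => // _.
  by case: diff => i lin dif; exists i => // /esym.
case=> i lin; rewrite (yP b k.+1) // (yP b' k.+1) //; apply.
by move: yb => /(congr1 (fun z : cantor => z i)).
Qed.

End LusinNovikov.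

Theorem lusin_novikov (E : set (cantor * cantor)) :
  souslin digit2 E -> (forall x, countable [set y | E (x, y)]) ->
  exists2 f : nat -> cantor -> cantor, forall k, borel_map (f k) &
    forall x y, E (x, y) -> exists k, y = f k x.
Proof.
case=> C Ccl CE Ecount; have [f bf funiv] := universal_family C.
exists f => // x y Exy; apply: contrapT => /forallNP fy.
have [|x' [z [zinj zE]]] := perfect_section Ccl bf funiv.
  exists x; split=> // t; rewrite /nodes inE => /eqP ->.
  exists y; split; last exact: fy.
  by have [/(_ Exy)[w Cw] _] := CE (x, y); exists w.
have /countable_injP[g ginj] := Ecount x'.
apply: (@no_injection_cantor (g \o z)) => b b' /= gb; apply: zinj.
by apply: ginj => //; apply/mem_set/CE; exact: zE.
Qed.

(** * Polish spaces inside the Cantor space *)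

Section MeasurableConnectives.
Context d (T : measurableType d).

Lemma measurable_exists_inj (I : Type) (c : I -> nat) (A : I -> T -> Prop) :
  injective c -> (forall i, measurable (A i)) ->
  measurable (fun x => exists i, A i x).
Proof.
move=> cinj mA; rewrite (_ : (fun x => _) =
    \bigcup_n (fun x => exists2 i, c i = n & A i x)).
  apply: bigcupT_measurable => n; have [[i <-]|nc] :=
    pselect (exists i, c i = n).
    rewrite (_ : (fun x => _) = A i) //.
    by apply/seteqP; split=> x; [case=> j /cinj ->|exists i].
  rewrite (_ : (fun x => _) = set0) //.
  by apply/seteqP; split=> x // -[i ci _]; apply: nc; exists i.
by apply/seteqP; split=> x [i]; [exists (c i) => //;
  exists i|move=> _ [j _ Ajx]; exists j].
Qed.

Lemma measurable_forall_inj (I : Type) (c : I -> nat) (A : I -> T -> Prop) :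
  injective c -> (forall i, measurable (A i)) ->
  measurable (fun x => forall i, A i x).
Proof.
move=> cinj mA; rewrite (_ : (fun x => _) = ~` (fun x => exists i, ~ A i x)).
  apply/measurableC/(measurable_exists_inj cinj) => i;
    exact: (measurableC (mA i)).
by apply/seteqP; split=> x /=; [move=> xA [i]; apply|move=> /forallNP xA i;
  exact: contrapT].
Qed.

Lemma measurable_exists (I : countType) (A : I -> T -> Prop) :
  (forall i, measurable (A i)) -> measurable (fun x => exists i, A i x).
Proof. exact: measurable_exists_inj (pcan_inj pickleK). Qed.

Lemma measurable_forall (I : countType) (A : I -> T -> Prop) :
  (forall i, measurable (A i)) -> measurable (fun x => forall i, A i x).
Proof. exact: measurable_forall_inj (pcan_inj pickleK). Qed.

Lemma measurable_prop (P : Prop) : measurable (fun _ : T => P).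
Proof.
have [p|np] := pselect P.
  by rewrite (_ : (fun=> P) = setT) //; apply/seteqP; split.
by rewrite (_ : (fun=> P) = set0) //; apply/seteqP; split.
Qed.

Lemma measurable_and (A B : T -> Prop) : measurable A -> measurable B ->
  measurable (fun x => A x /\ B x).
Proof. exact: measurableI. Qed.

Lemma measurable_imply (A B : T -> Prop) : measurable A -> measurable B ->
  measurable (fun x => A x -> B x).
Proof.
move=> mA mB; rewrite (_ : (fun x => _) = ~` A `|` B).
  by apply: measurableU => //; exact: measurableC.
apply/seteqP; split=> x /=; last by case=> // nA /nA.
by move=> AB; have [/AB|] := pselect (A x); [right|left].
Qed.

Lemma measurable_iff (A B : T -> Prop) : measurable A -> measurable B ->
  measurable (fun x => A x <-> B x).
Proof. by move=> mA mB; apply: measurable_and; exact: measurable_imply. Qed.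

Lemma measurable_preimage_generated (Z : Type) (f : T -> Z) (G : set (set Z)) :
  (forall A, G A -> measurable (f @^-1` A)) ->
  forall A, <<s G >> A -> measurable (f @^-1` A).
Proof.
move=> mG; suff sub : <<s G >> `<=` [set A | measurable (f @^-1` A)].
  by move=> A /sub.
apply: smallest_sub => //; split=> [|A mA|A mA] /=.
- by rewrite preimage_set0.
- by rewrite setTD; exact: measurableC mA.
- by rewrite preimage_bigcup; exact: bigcupT_measurable.
Qed.

End MeasurableConnectives.

Local Notation cspace := (g_sigma_algebraType cylinders).

Section MetricDigits.
Context (R : realType) (M : completeMetricType R).
Local Open Scope ring_scope.

Lemma dense_sequence : separable_space M -> exists q : nat -> M,
  forall x (e : R), 0 < e -> exists k, mdist x (q k) < e.
Proof.
case=> D Dcount Ddense.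
have [q qD] : exists q : nat -> M, D `<=` range q.
  have /countable_injP[g ginj] := Dcount.
  exists (fun n => if pselect (exists2 x,
    D x & g x = n) is left h then s2val (cid2 h) else point).
  move=> x Dx; exists (g x) => //; case: pselect => [h|]; last by case;
    exists x.
  by case: cid2 => y Dy gy /=; apply: ginj; rewrite ?inE.
exists q => x e e0; have [||y [xy /qD[k _ qk]]] := Ddense (ball x e)^°.
- by exists x; apply: nbhsx_ballx.
- exact: open_interior.
exists k; rewrite qk.
by have := interior_subset xy; rewrite ballEmdist.
Qed.

Variable q : nat -> M.
Hypothesis q_dense : forall x (e : R), 0 < e -> exists k, mdist x (q k) < e.

Definition rad (j : nat) : R := j.+1%:R^-1.

Lemma rad_gt0 j : 0 < rad j. Proof. by rewrite invr_gt0 ltr0n. Qed.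

Lemma rad_lt (e : R) : 0 < e -> exists J, forall j, (J <= j)%N -> rad j < e.
Proof.
move=> e0; have [J _ JP] := near_infty_natSinv_lt (PosNum e0).
by exists J => j /JP.
Qed.

Definition metric_digits (x : M) : cantor := fun m =>
  if @pickle_inv (nat * nat)%type m is Some (k, j) then mdist x (q k) < rad j
  else false.

Definition bit (z : cantor) (k j : nat) := z (pickle (k, j)) = true.

Lemma metric_digitsE x k j : bit (metric_digits x) k j <->
  mdist x (q k) < rad j.
Proof. by rewrite /bit /metric_digits pickleK_inv. Qed.

Lemma metric_digits_inj : injective metric_digits.
Proof.
move=> x y xy; apply: contrapT => /eqP nxy.
have d0 : 0 < mdist x y / 2 by rewrite divr_gt0 // mdist_gt0.
have [j /(_ j (leqnn _)) jd] := rad_lt d0.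
have [k xk] := q_dense x (rad_gt0 j).
have yk : mdist y (q k) < rad j by apply/metric_digitsE; rewrite -xy;
  exact/metric_digitsE.
have := metric_triangle x (q k) y; rewrite leNgt => /negP; apply.
rewrite [mdist x y]splitr ltrD // ?(lt_trans xk) // metric_sym.
exact: lt_trans jd.
Qed.

(** Let the digit coded by [k] and [j] say that the ball of radius [rad j] around
    [q k] is listed. The sequences of points of [M] are those for which each
    scale has a listed ball, a ball is listed exactly if some listed ball is
    formally inside it, and any two listed balls are formally close. Only
    distances between points of [q] occur, so that this set is evidently
    Borel. *)
Definition coherent : set cantor := [set z | [/\
  forall m, @pickle_inv (nat * nat)%type m = None -> z m = false,
  forall j, exists k, bit z k j,
  forall k j, bit z k j <->
    exists p : nat * nat, bit z p.1 p.2 /\ mdist (q k) (q p.1) + rad p.2 < rad j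
      &
  forall k j k' j', bit z k j -> bit z k' j' ->
    mdist (q k) (q k') < rad j + rad j']].

(** The centres of listed balls of radii tending to zero form a Cauchy sequence;
    its limit has the given digits. *)
Lemma range_metric_digits : range metric_digits = coherent.
Proof.
apply/seteqP; split=> z.
  case=> x _ <-; split.
  - by move=> m; rewrite /metric_digits => ->.
  - move=> j; have [k xk] := q_dense x (rad_gt0 j).
    by exists k; exact/metric_digitsE.
  - move=> k j; rewrite metric_digitsE; split=> [xk|[[k' j'] []]]; last first.
      rewrite metric_digitsE /= => xk' kk'.
      rewrite (le_lt_trans _ kk') // (le_trans (metric_triangle x (q k') _)) //.
      by rewrite addrC (metric_sym (q k)) lerD2l ltW.
    have e0 : 0 < (rad j - mdist x (q k)) / 2 by rewrite divr_gt0 // subr_gt0.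
    have [j' /(_ j' (leqnn _)) jj'] := rad_lt e0.
    have [k' xk'] := q_dense x (rad_gt0 j').
    exists (k', j'); split=> /=; first exact/metric_digitsE.
    rewrite (@le_lt_trans _ _ (mdist x (q k) + rad j' + rad j')) //.
      rewrite lerD2r (le_trans (metric_triangle _ x _)) // metric_sym lerD2l.
      exact: ltW.
    by rewrite -addrA -ltrBrDl [ltRHS]splitr ltrD.
  - move=> k j k' j'; rewrite !metric_digitsE => xk xk'.
    by rewrite (le_lt_trans (metric_triangle _ x _)) // (metric_sym (q k)) ltrD.
case=> z0 /choice[c cz] zopen zC.
pose F := (fun j => q (c j)) @ \oo.
have /cauchy_cvg/cvg_ex[x Fx] : cauchy F.
  apply: cauchy_exP => e e0; have [j0 j0e] : exists J, forall j, (J <= j)%N ->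
    rad j < e / 2.
    by apply: rad_lt; rewrite divr_gt0.
  exists (q (c j0)); exists j0 => // j /= j0j; rewrite ballEmdist /=.
  by rewrite (lt_trans (zC _ _ _ _ (cz j0) (cz j))) // [ltRHS]splitr ltrD //
    j0e.
have near_x (e : R) : 0 < e -> exists j, mdist (q (c j)) x < e /\ rad j < e.
  move=> e0; have [J Je] := rad_lt e0.
  have [n _ nF] := Fx _ (nbhsx_ballx x e e0).
  exists (maxn n J); split; last by rewrite Je // leq_maxr.
  by have := nF (maxn n J) (leq_maxl _ _); rewrite /= ballEmdist /= metric_sym.
have lex k j : bit z k j -> mdist (q k) x <= rad j.
  move=> kj; apply/ler_addgt0Pr => e e0.
  have [|i [xi ie]] := near_x (e / 2); first by rewrite divr_gt0.
  rewrite (le_trans (metric_triangle _ (q (c i)) _)) // [e in leRHS]splitr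
    addrA.
  rewrite lerD ?(ltW xi) // (le_trans (ltW (zC _ _ _ _ kj (cz i)))) //.
  by rewrite lerD2l ltW.
exists x => //; apply/funext => m.
case kjE : (@pickle_inv (nat * nat)%type m) => [[k j]|]; last first.
  by rewrite z0 // /metric_digits kjE.
have {kjE}<- : pickle (k, j) = m by have /= := @pickle_invK (nat * nat)%type m;
  rewrite kjE.
suff xkj : bit (metric_digits x) k j <-> bit z k j by apply/idP/idP => /xkj.
rewrite metric_digitsE; split=> [xk|kj]; last first.
  have [[k' j'] /= [kj' kk']] := (zopen k j).1 kj.
  rewrite metric_sym (le_lt_trans _ kk') //
    (le_trans (metric_triangle _ (q k') _)) //.
  by rewrite lerD2l lex.
apply/zopen; have [|i [xi ie]] := near_x ((rad j - mdist x (q k)) / 2).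
  by rewrite divr_gt0 // subr_gt0.
exists (c i, i); split=> //=.
rewrite (@le_lt_trans _ _ (mdist x (q k) + mdist (q (c i)) x + rad i)) //.
  by rewrite lerD2r (le_trans (metric_triangle _ x _)) // metric_sym
    (metric_sym x (q (c i))).
by rewrite -addrA -ltrBrDl [ltRHS]splitr ltrD.
Qed.

Lemma coherent_borel : cantor_borel coherent.
Proof.
have bbit k j : @measurable _ cspace (fun z => bit z k j) by exact: borel_digit.
rewrite (_ : coherent =
  [set z | forall m, @pickle_inv (nat * nat)%type m = None -> z m = false] `&`
  [set z | forall j, exists k, bit z k j] `&`
  [set z | forall k j, bit z k j <-> exists p : nat * nat, bit z p.1 p.2 /\
     mdist (q k) (q p.1) + rad p.2 < rad j] `&`
  [set z | forall k j k' j', bit z k j -> bit z k' j' ->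
    mdist (q k) (q k') < rad j + rad j']); last first.
  by apply/seteqP; split=> z; [case|case=> [[[]]]].
apply: (@measurableI _ cspace); first apply: (@measurableI _ cspace);
  first apply: (@measurableI _ cspace).
- apply: (@measurable_forall _ cspace) => m;
    apply: (@measurable_imply _ cspace).
    exact: measurable_prop.
  exact: borel_digit.
- apply: (@measurable_forall _ cspace) => j;
    apply: (@measurable_exists _ cspace) => k.
  exact: bbit.
- apply: (@measurable_forall _ cspace) => k;
    apply: (@measurable_forall _ cspace) => j.
  apply: (@measurable_iff _ cspace); first exact: bbit.
  apply: (@measurable_exists _ cspace) => p; apply: (@measurable_and _ cspace).
    exact: bbit.
  exact: measurable_prop.
- apply: (@measurable_forall _ cspace) => k;
    apply: (@measurable_forall _ cspace) => j.
  apply: (@measurable_forall _ cspace) => k';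
    apply: (@measurable_forall _ cspace) => j'.
  apply: (@measurable_imply _ cspace); first exact: bbit.
  apply: (@measurable_imply _ cspace); first exact: bbit.
  exact: measurable_prop.
Qed.

(** An open set is a countable union of balls around the points [q k]. *)
Lemma metric_digits_measurable (B : set (borel_space M)) :
  measurable B <-> exists2 B', cantor_borel B' & B = metric_digits @^-1` B'.
Proof.
split; last first.
  case=> B' bB' ->.
  apply: (measurable_preimage_generated (T := borel_space M)) bB' => _ [m ->].
  apply: sub_gen_smallest; rewrite /preimage /mkset /metric_digits /=.
  case: (@pickle_inv (nat * nat)%type m) => [[k j]|]; last first.
    by rewrite (_ : (fun=> _) = set0); [exact: open0|apply/seteqP; split].
  rewrite openE => x /= xk; apply/nbhs_ballP; exists (rad j - mdist x (q k)).
    by rewrite /= subr_gt0.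
  move=> y; rewrite ballEmdist /= ltrBrDr => xy; apply: le_lt_trans xy.
  by rewrite (le_trans (metric_triangle _ x _)) // (metric_sym y).
suff sub : @measurable _ (borel_space M) `<=`
    [set B | exists2 B', cantor_borel B' & B =
      metric_digits @^-1` B'] by move/sub.
apply: smallest_sub.
  split=> [|A [B' bB' ->]|A /(_ _)/cid2-/all_sig2[B' bB' AB']] /=.
  - by exists set0; [exact: borel0|rewrite preimage_set0].
  - by exists (~` B'); [exact: borelC|rewrite setTD preimage_setC].
  - exists (\bigcup_k B' k); first exact: borel_bigcup.
    by rewrite preimage_bigcup; apply: eq_bigcupr => k _.
move=> U oU; exists [set z | exists p : nat * nat,
    [set x : M | mdist x (q p.1) < rad p.2] `<=` U /\ bit z p.1 p.2].
  apply: (@measurable_exists _ cspace) => p; apply: (@measurableI _ cspace).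
    exact: measurable_prop.
  exact: borel_digit.
apply/seteqP; split=> x /=; last first.
  by case=> p [pU /metric_digitsE xp]; exact: pU.
move: oU; rewrite openE => /[apply]/nbhs_ballP[e /= e0 xU].
have [j /(_ _ (leqnn _)) je] : exists J, forall j, (J <= j)%N -> rad j < e / 2.
  by apply: rad_lt; rewrite divr_gt0.
have [k xk] := q_dense x (rad_gt0 j); exists (k, j); split;
  last exact/metric_digitsE.
move=> y /= yk; apply: xU; rewrite ballEmdist /=
  (le_lt_trans (metric_triangle _ (q k) _)) //.
by rewrite [ltRHS]splitr (metric_sym _ y) ltrD // (lt_trans _ je).
Qed.

End MetricDigits.

(** * Countable Borel equivalence relations are generated by involutions *)

Lemma standard_borel_cantor (R : realType) d (Y : measurableType d) :
  standard_borel R Y -> exists e : Y -> cantor,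
  [/\ injective e, cantor_borel (range e) & forall B,
   measurable B <-> exists2 B', cantor_borel B' & B = e @^-1` B'].
Proof.
case=> M /dense_sequence[q q_dense] [f fbij fB].
have finj := bij_inj fbij.
exists (metric_digits q \o f); split.
- by move=> x y /(metric_digits_inj q_dense)/finj.
- rewrite (_ : range _ = range (metric_digits q)).
    by rewrite (range_metric_digits q_dense); exact: coherent_borel.
  apply/seteqP; split=> z [x _ <-]; first by exists (f x).
  by have [g _ gf] := fbij; exists (g x) => //=; rewrite gf.
move=> B; have fK : B = f @^-1` (f @` B).
  by apply/seteqP; split=> [y By|y [y' By' /finj <-]//]; exists y.
rewrite {1}fK -fB (metric_digits_measurable q_dense).
split=> -[B' bB' BB']; exists B' => //; first by rewrite fK BB'.
apply/seteqP; split=> x; first by case=> y; rewrite BB' => ? <-.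
by have [g _ gf] := fbij; rewrite -(gf x) BB' => ?; exists (g x).
Qed.

Section Retract.
Context d (Y : measurableType d) (e : Y -> cantor).
Hypothesis e_inj : injective e.
Hypothesis e_range : cantor_borel (range e).
Hypothesis e_measurable : forall B,
   measurable B <-> exists2 B', cantor_borel B' & B = e @^-1` B'.

(** The retraction is Borel because the range of [e] is. *)
Lemma borel_retract : exists r : cantor -> Y, cancel e r /\
  forall B, measurable B -> cantor_borel (r @^-1` B).
Proof.
pose r z := if pselect (exists y, e y =
  z) is left h then projT1 (cid h) else point.
have er : cancel e r.
  move=> y; rewrite /r; case: pselect => [h|]; last by case; exists y.
  by case: cid => y' /= /e_inj.
exists r; split=> // B /e_measurable[B' bB' BB'].
rewrite (_ : _ @^-1` _ = (range e `&` B') `|` (~` range e `&` [set _ |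
  B point])).
  apply: borelU; first exact: borelI.
  by apply: borelI; [exact: borelC|exact: (@measurable_prop _ cspace)].
apply/seteqP; split=> z /=.
  have [[y _ <-]|nz] := pselect (range e z).
    by rewrite er BB' => ?; left; split=> //; exists y.
  rewrite {1}/r; case: pselect => [[y yz]|]; first by case: nz; exists y.
  by right.
case=> [[[y _ <-] ey]|[nz Bp]]; first by rewrite er BB'.
by rewrite /r; case: pselect => // -[y yz]; case: nz; exists y.
Qed.

End Retract.

Lemma measurable_fun_pselect d (Y : measurableType d) d' (Z : measurableType d')
    (A : set Y) (f g : Y -> Z) : measurable A -> measurable_fun setT f ->
  measurable_fun setT g ->
  measurable_fun setT (fun y => if pselect (A y) then f y else g y).
Proof.
move=> mA mf mg _ B mB; rewrite setTI.
rewrite (_ : _ @^-1` _ = A `&` f @^-1` B `|` ~` A `&` g @^-1` B); last first.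
  apply/seteqP; split=> y; rewrite /preimage /=; case: pselect => Ay.
  - by left.
  - by right.
  - by case=> -[].
  - by case=> -[].
have mfB : measurable (f @^-1` B) by rewrite -[_ @^-1` _]setTI; exact: mf.
have mgB : measurable (g @^-1` B) by rewrite -[_ @^-1` _]setTI; exact: mg.
apply: measurableU; first exact: measurableI.
by apply: measurableI => //; exact: measurableC.
Qed.

Section FeldmanMoore.
Context (R : realType) d (Y : measurableType d) (E : Y -> Y -> Prop).
Hypothesis E_cber : countable_borel_equivalence R E.

(** In the Cantor space [E] becomes an analytic relation with countable sections,
    and is covered by Borel functions, whose values the retraction brings back
    to [Y]. *)
Lemma cover_by_maps : exists (e : Y -> cantor) (g : nat -> Y -> Y),
  [/\ injective e, forall i, measurable [set y | e y i],
      forall n, measurable_fun setT (g n) &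
      forall x y, E x y -> exists n, g n x = y].
Proof.
have [sY _ mE cE] := E_cber.
have [e [einj erange eB]] := standard_borel_cantor sY.
have [r [er rB]] := borel_retract einj erange eB.
pose E' := [set p : cantor * cantor |
  [/\ range e p.1, range e p.2 & E (r p.1) (r p.2)]].
have cyl_fst A : cylinders A -> bisouslin digit2 (fst @^-1` A).
  by case=> i ->; exact (@bisouslin_digit _ _ digit2 i [set b : bool * bool |
    b.1]).
have cyl_snd A : cylinders A -> bisouslin digit2 (snd @^-1` A).
  by case=> i ->; exact (@bisouslin_digit _ _ digit2 i [set b : bool * bool |
    b.2]).
have bor_fst A : cantor_borel A -> bisouslin digit2 (fst @^-1` A).
  exact: bisouslin_preimage.
have bor_snd A : cantor_borel A -> bisouslin digit2 (snd @^-1` A).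
  exact: bisouslin_preimage.
have sE' : souslin digit2 E'.
  rewrite (_ : E' = fst @^-1` range e `&` (snd @^-1` range e `&`
    (fun p => (r p.1, r p.2)) @^-1` [set p | E p.1 p.2])); last first.
    by apply/seteqP; split=> p /= [? //]; case.
  apply: souslinI; first exact: (bor_fst _ erange).1.
  apply: souslinI; first exact: (bor_snd _ erange).1.
  have gen A : (preimage_set_system setT (@fst Y Y) measurable `|`
      preimage_set_system setT (@snd Y Y) measurable) A ->
      bisouslin digit2 ((fun p => (r p.1, r p.2)) @^-1` A).
    case=> -[B mB <-]; rewrite setTI;
      [exact: bor_fst (rB _ mB)|exact: bor_snd (rB _ mB)].
  exact: (bisouslin_preimage gen mE).1.
have cE' x : countable [set y | E' (x, y)].
  apply: (sub_countable _ (cE (r x))); apply: card_le_trans (card_image_le e _).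
  apply: subset_card_le => y [/= _ [y' _ <-] Exy]; exists y' => //=.
  by rewrite er in Exy.
have [f bf fE'] := lusin_novikov sE' cE'.
have me i : measurable [set y | e y i].
  by apply/eB; exists [set z | z i] => //; exact: (borel_digit _ true).
exists e, (fun n y => r (f n (e y))); split=> //; last first.
  move=> x y Exy; have [|n eyf] := fE' (e x) (e y).
    by split=> /=; [exists x|exists y|rewrite !er].
  by exists n; rewrite -eyf er.
move=> n _ B mB; rewrite setTI; apply/eB.
exists ((r \o f n) @^-1` B) => //; rewrite comp_preimage.
apply: (measurable_preimage_generated (T := cspace)) (rB _ mB).
by move=> _ [i ->]; exact: bf.
Qed.

(** The Borel maps [g n] that cover [E] need not be injective. An involution
    exchanges [y] with [g n y] where [g m] maps [g n y] back to [y] and a fixed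
    digit is one at [y] and zero at [g n y]; this digit keeps the two sides of
    the exchange disjoint. *)
Theorem feldman_moore : exists (e : Y -> cantor) (s : nat -> Y -> Y),
  [/\ injective e, forall i, measurable [set y | e y i],
      forall n, measurable_fun setT (s n),
      forall n, involutive (s n) &
      forall x y, E x y -> exists n, s n x = y].
Proof.
have [e [g [einj me mg gE]]] := cover_by_maps.
have [_ [_ Esym _] _ _] := E_cber.
pose D n m i b y := [/\ g m (g n y) = y, e y i = b & e (g n y) i = ~~ b].
pose swap n m i y := if pselect (D n m i true y) then g n y
  else if pselect (D m n i false y) then g m y else y.
have mei (h : Y -> Y) i b : measurable_fun setT h ->
  measurable [set y | e (h y) i = b].
  move=> mh; have mhi : measurable [set y | e (h y) i].
    by rewrite -[mkset _]setTI; exact: (mh measurableT _ (me i)).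
  case: b => //; rewrite (_ : mkset _ = ~` [set y | e (h y) i]);
    first exact: measurableC.
  by apply/seteqP; split=> y /= => [->|/negP/negbTE].
have mD n m i b : measurable (D n m i b).
  rewrite (_ : D n m i b = (fun y => forall j, e (g m (g n y)) j = true <->
    e y j = true) `&`
    [set y | e y i = b] `&` [set y | e (g n y) i = ~~ b]); last first.
    apply/seteqP; split=> y; first by case=> gg ? ?; split=> //; split=> // j;
      rewrite gg.
    by case=> -[gg ? ?]; split=> //; apply/einj/funext => j;
      apply/idP/idP => /gg.
  apply: measurableI; last exact: mei.
  apply: measurableI; last exact: (mei id).
  apply: measurable_forall => j; apply: measurable_iff; last exact: (mei id).
  by apply: (mei (g m \o g n)); exact: measurableT_comp.
have mswap n m i : measurable_fun setT (swap n m i).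
  apply: measurable_fun_pselect => //; apply: measurable_fun_pselect => //.
have swap1 n m i y : D n m i true y -> swap n m i y = g n y.
  by move=> Dy; rewrite /swap; case: pselect.
have swap2 n m i y : D m n i false y -> swap n m i y = g m y.
  move=> Dy; rewrite /swap; case: pselect => [[? ei ?]|?] /=;
    last by case: pselect.
  by case: Dy => _; rewrite ei.
have swapK n m i : involutive (swap n m i).
  move=> y; have [Dy|nD] := pselect (D n m i true y).
    have [gg ei gi] := Dy; rewrite (swap1 _ _ _ y) // swap2 //.
    by split; rewrite ?gg.
  have [Dy|nD'] := pselect (D m n i false y).
    have [gg ei gi] := Dy; rewrite (swap2 _ _ _ y) // swap1 //.
    by split; rewrite ?gg.
  have -> : swap n m i y = y by rewrite /swap; case: pselect => // ? /=;
    case: pselect.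
  by rewrite /swap; case: pselect => // ? /=; case: pselect.
pose s k := if @pickle_inv (option (nat * nat * nat)) k is Some (Some (n, m, i))
  then swap n m i else id.
exists e, s; split=> //.
- by move=> k; rewrite /s; case: pickle_inv => [[[[n m] i]|]|] //;
    exact: measurable_id.
- by move=> k; rewrite /s; case: pickle_inv => [[[[n m] i]|]|] //.
move=> x y Exy; have [<-|nxy] := pselect (x = y).
  by exists (pickle (None : option (nat * nat * nat))); rewrite /s pickleK_inv.
have [i exy] : exists i, e x i <> e y i.
  apply: contrapT => /forallNP exy; apply/nxy/einj/funext => i.
  exact: contrapT.
have [n gx] := gE _ _ Exy; have [m gy] := gE _ _ (Esym _ _ Exy).
have eyi : e y i = ~~ e x i by case: (e y i) exy; case: (e x i).
case exi: (e x i) eyi => /= eyi.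
  exists (pickle (Some (n, m, i))); rewrite /s pickleK_inv swap1 //.
  by split; rewrite ?gx ?gy.
exists (pickle (Some (m, n, i))); rewrite /s pickleK_inv swap2 //.
by split; rewrite ?gx ?gy.
Qed.

End FeldmanMoore.

(** * Closed codes give standard Borel spaces *)

Section ClosedCodes.
Local Open Scope ring_scope.

Definition code_closed (T : Type) (c : T -> nat -> nat) :=
  forall z, (forall n, exists t, eq_upto n z (c t)) -> exists t, c t = z.

Section DigitMetric.
Variables (R : realType) (T : pointedType) (c : T -> nat -> nat).
Hypothesis c_inj : injective c.

Lemma first_difference (x y : T) : exists n, eq_upto n (c x) (c y) /\
  (x <> y -> c x n <> c y n).
Proof.
have [<-|nxy] := pselect (x = y); first by exists 0%N.
have ex : exists n, c x n != c y n.
  apply: contrapT => /forallNP eqc; apply/nxy/c_inj/funext => n.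
  by have /negP/negPn/eqP := eqc n.
exists (ex_minn ex); case: ex_minnP => n /eqP cn nmin; split=> // i lin.
by apply/eqP/negPn/negP => /nmin; rewrite leqNgt lin.
Qed.

(** The index of the first difference, for distinct points. *)
Definition agreement x y : nat := projT1 (cid (first_difference x y)).

Lemma agreementP x y : eq_upto (agreement x y) (c x) (c y) /\
  (x <> y -> c x (agreement x y) <> c y (agreement x y)).
Proof. by rewrite /agreement; case: cid. Qed.

Lemma eq_upto_agreement x y n : eq_upto n (c x) (c y) <->
  x = y \/ (n <= agreement x y)%N.
Proof.
have [eqa diff] := agreementP x y; split=> [eqn|[->//|na] i lin]; last first.
  by apply: eqa; exact: leq_trans na.
have [->|/diff cn] := pselect (x = y); first by left.
by right; rewrite leqNgt; apply/negP => /eqn.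
Qed.

Definition digit_dist (x y : T) : R :=
  if x == y then 0 else (agreement x y).+1%:R^-1.

Lemma digit_distxx x : digit_dist x x = 0. Proof. by rewrite /digit_dist eqxx.
Qed.

Lemma digit_dist_ge0 x y : 0 <= digit_dist x y.
Proof. by rewrite /digit_dist; case: eqP. Qed.

Lemma digit_dist_lt x y n :
  digit_dist x y < n.+1%:R^-1 <-> eq_upto n.+1 (c x) (c y).
Proof.
rewrite eq_upto_agreement /digit_dist; case: eqP => [->|nxy].
  by rewrite invr_gt0 ltr0n; split=> // _; left.
rewrite ltf_pV2 ?posrE ?ltr0n // ltr_nat ltnS.
by split=> [|[]//]; right.
Qed.

Lemma digit_dist_positivity x y : digit_dist x y = 0 -> x = y.
Proof. by rewrite /digit_dist; case: eqP => // _ /eqP;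
  rewrite invr_eq0 pnatr_eq0.
Qed.

Lemma digit_dist_sym x y : digit_dist x y = digit_dist y x.
Proof.
rewrite /digit_dist eq_sym; case: eqP => // nyx; congr (_.+1%:R^-1).
have half u v : u <> v -> (agreement u v <= agreement v u)%N.
  move=> uv; have : eq_upto (agreement u v) (c v) (c u).
    by move=> i iuv; rewrite (agreementP u v).1.
  by case/eq_upto_agreement => // vu; case: uv.
by apply/eqP; rewrite eqn_leq !half // => xy; apply: nyx.
Qed.

Lemma digit_dist_triangle y x z : digit_dist x z <= digit_dist x y + digit_dist
  y z.
Proof.
have [-> |/eqP xy] := eqVneq x y; first by rewrite digit_distxx add0r.
have [-> |/eqP yz] := eqVneq y z; first by rewrite digit_distxx addr0.
have [-> |/eqP xz] := eqVneq x z; first by rewrite digit_distxx addr_ge0 //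
  digit_dist_ge0.
pose n := minn (agreement x y) (agreement y z).
have /eq_upto_agreement[//|] : eq_upto n (c x) (c z).
  move=> i; rewrite leq_min => /andP[ixy iyz].
  by rewrite (agreementP x y).1 // (agreementP y z).1.
have pos u v : u <> v -> digit_dist u v = (agreement u v).+1%:R^-1.
  by rewrite /digit_dist; case: eqP.
rewrite geq_min => /orP[] le; [rewrite -[leLHS]addr0|rewrite -[leLHS]add0r];
  by rewrite lerD ?digit_dist_ge0 // !pos // lef_pV2 ?posrE ?ltr0n // ler_nat.
Qed.

End DigitMetric.

(** An alias of [T], which carries the metric of the Baire space pulled back
    along [c]. *)
Definition digit_space (R : realType) (T : pointedType) (c : T -> nat -> nat)
  (c_inj : injective c) (c_closed : code_closed c) : Type := T.

Section DigitSpace.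
Variables (R : realType) (T : pointedType) (c : T -> nat -> nat).
Hypotheses (c_inj : injective c) (c_closed : code_closed c).

Local Notation M := (digit_space R c_inj c_closed).

HB.instance Definition _ := Pointed.on M.
HB.instance Definition _ := @isMetric.Build R M (digit_dist R c_inj)
  (digit_distxx R c_inj) (@digit_dist_positivity R T c c_inj)
  (digit_dist_sym R c_inj) (digit_dist_triangle R c_inj).

Lemma digit_ballE (x : M) n : ball x (n.+1%:R^-1 : R) =
  [set y | eq_upto n.+1 (c x) (c y)].
Proof.
rewrite ballEmdist; apply/seteqP.
by split=> y /= h; apply/(digit_dist_lt R c_inj).
Qed.

(** A Cauchy filter determines all the digits of a sequence, which is the code of
    a point because the range of [c] is closed. *)
Lemma digit_space_complete (F : set_system M) : ProperFilter F -> cauchy F ->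
  cvg F.
Proof.
move=> PF /cauchyP Fcauchy.
have /choice[t tP] n : exists t, F [set y | eq_upto n.+1 (c t) (c y)].
  have [|t] := Fcauchy n.+1%:R^-1; first by rewrite invr_gt0 ltr0n.
  by rewrite digit_ballE; exists t.
pose z i := c (t i) i.
have zt n : eq_upto n.+1 z (c (t n)).
  move=> i lin; have [y [/= iy ny]] :=
    @filter_ex _ _ PF _ (filterI (tP i) (tP n)).
  by rewrite /z iy // ny.
have [|x xz] := c_closed (z := z).
  by move=> n; exists (t n) => i lin; apply: zt; exact: ltnW.
apply/cvg_ex; exists x => A /nbhs_ballP[e /= e0 xA].
have [n _ nP] := near_infty_natSinv_lt (PosNum e0).
apply: filterS (tP n) => y ty; apply: xA.
apply: (@le_ball _ _ _ n.+1%:R^-1); first by apply/ltW/nP => /=.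
by rewrite digit_ballE /= xz => i lin; rewrite (zt n) // ty.
Qed.

HB.instance Definition _ := Uniform_isComplete.Build M digit_space_complete.

Lemma digit_space_separable : separable_space M.
Proof.
have /choice[p pP] (s : seq nat) : exists t : M,
    (exists t', eq_upto (size s) (nth 0%N s) (c t')) ->
      eq_upto (size s) (nth 0%N s) (c t).
  have [[t st]|ns] := pselect (exists t', eq_upto (size s) (nth 0%N s) (c t')).
    by exists t.
  by exists point.
exists (range p).
  by apply: sub_countable (card_image_le _ _) _; exact: countableP.
move=> O [x Ox]; rewrite openE => /(_ x Ox)/nbhs_ballP[e /= e0 xO].
have [n _ nP] := near_infty_natSinv_lt (PosNum e0).
exists (p (mkseq (c x) n.+1)); split; last by eexists.
apply: xO; apply: (@le_ball _ _ _ n.+1%:R^-1); first by apply/ltW/nP => /=.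
rewrite digit_ballE /= => i lin.
have := pP (mkseq (c x) n.+1); rewrite size_mkseq => /(_ _ i lin) <-;
  first by rewrite nth_mkseq.
by exists x => j ljn; rewrite nth_mkseq.
Qed.

End DigitSpace.

Lemma standard_borel_code (R : realType) d (T : measurableType d)
    (c : T -> nat -> nat) : injective c -> code_closed c ->
  (forall i k, measurable [set t | c t i = k]) ->
  (forall B, measurable B ->
     <<s [set A | exists i k, A = [set t | c t i = k]] >> B) ->
  standard_borel R T.
Proof.
move=> ci cc cm cgen; pose M := digit_space R ci cc.
exists M; first exact: digit_space_separable.
exists id; first by exists id.
move=> B; split.
  suff sub : @measurable _ (borel_space M) `<=` @measurable _ T by exact: sub.
  apply: smallest_sub; first exact: sigma_algebra_measurable.
  move=> U oU; rewrite (_ : U = fun x => exists s : seq nat,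
      [set y | eq_upto (size s) (nth 0%N s) (c y)] `<=` U /\
      forall i, (i < size s)%N -> c x i = nth 0%N s i).
    apply: measurable_exists => s; apply: measurable_and;
      first exact: measurable_prop.
    apply: measurable_forall => i; apply: measurable_imply;
      first exact: measurable_prop.
    exact: cm.
  apply/seteqP; split=> x; last first.
    by case=> s [sU xs]; apply: sU => i lis; rewrite -xs.
  move: oU; rewrite openE => /[apply]/nbhs_ballP[e /= e0 xU].
  have [n _ nP] := near_infty_natSinv_lt (PosNum e0).
  exists (mkseq (c x) n.+1); rewrite size_mkseq; split=> [y xy|i lin];
    last by rewrite nth_mkseq.
  apply: xU; apply: (@le_ball _ _ _ n.+1%:R^-1); first by apply/ltW/nP => /=.
  by rewrite digit_ballE /= => i lin; rewrite -xy // nth_mkseq.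
move=> mB; have := cgen _ mB.
suff sub : <<s [set A | exists i k, A = [set t | c t i = k]] >> `<=`
  @measurable _ (borel_space M) by exact: sub.
apply: smallest_sub; first exact: sigma_algebra_measurable.
move=> _ [i [k ->]]; apply: sub_gen_smallest.
rewrite openE => x /= xi; apply/nbhs_ballP; exists i.+1%:R^-1 => /=.
  by rewrite invr_gt0 ltr0n.
by rewrite digit_ballE => y /= <-.
Qed.

End ClosedCodes.

(** * Morphisms, quotients and bi-orderings of groups *)

Local Open Scope group_scope.

HB.instance Definition _ (T : countType) := [Countable of free_group T by <:].

Section Morphisms.
Variables (G H : groupType) (f : G -> H).
Hypothesis fM : {morph f : x y / x * y}.

Lemma morph1 : f 1 = 1.
Proof. by apply: (mulgI (f 1)); rewrite -fM !mulg1. Qed.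

Lemma morphV x : f x^-1 = (f x)^-1.
Proof. by apply: (mulgI (f x)); rewrite -fM !mulgV morph1. Qed.

Lemma bijective_isomorphic : bijective f -> group_isomorphic G H.
Proof.
move=> fbij.
pose fm : {multiplicative G -> H} :=
  HB.pack f (isMultiplicative.Build G H f fM).
by exists fm.
Qed.

End Morphisms.

Lemma group_isomorphic_sym (G H : groupType) :
  group_isomorphic G H -> group_isomorphic H G.
Proof.
case=> f [g fK gK]; apply: (@bijective_isomorphic _ _ g); last by exists f.
by move=> x y; rewrite (can2_gmulfM fK gK).
Qed.

Lemma group_isomorphic_trans (G H K : groupType) :
  group_isomorphic G H -> group_isomorphic H K -> group_isomorphic G K.
Proof.
case=> f fbij [g gbij]; apply: (@bijective_isomorphic _ _ (g \o f)).
  by move=> x y /=; rewrite !gmulfM.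
exact: bij_comp.
Qed.

Section QuotientMorphism.
Variables (G : groupType) (N : normal_subgroup G).

Lemma cosetM : {morph coset N : x y / x * y}.
Proof. by move=> x y; rewrite -[LHS]quotient_mulE. Qed.

Lemma coset_eq1 x : coset N x = 1 <-> N x.
Proof.
rewrite -[1]/(coset N 1) coset_eq mulg1; split=> [/normalV|/normalV //].
by rewrite invgK.
Qed.

Lemma quotient_isomorphic (K : groupType) (f : G -> K) :
  {morph f : x y / x * y} -> (forall k, exists g, f g = k) ->
  (forall g, N g <-> f g = 1) -> group_isomorphic (quotient N) K.
Proof.
move=> fM fsurj fker; pose h (u : quotient N) := f (repr u).
have fE x y : coset N x = coset N y <-> f x = f y.
  rewrite coset_eq fker fM (morphV fM); split=> [fxy|->]; last by rewrite mulVg.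
  by apply: (mulgI (f x)^-1); rewrite fxy mulVg.
have hE x : h (coset N x) = f x by apply/fE; rewrite coset_repr.
apply: (@bijective_isomorphic _ _ h).
  move=> u v; rewrite -(coset_repr u) -(coset_repr v) -cosetM.
  by rewrite !hE fM.
have /choice[g gK] := fsurj; exists (coset N \o g) => [u|k] /=.
  by rewrite -[RHS]coset_repr; apply/fE; rewrite gK.
by rewrite hE.
Qed.

End QuotientMorphism.

Section FreeGroupMorphism.
Variables (T : choiceType).
Implicit Types (l : T * bool) (w : seq (T * bool)).

Definition eval_letter (G : groupType) (phi : T -> G) l :=
  if l.2 then (phi l.1)^-1 else phi l.1.

Definition eval_word (G : groupType) (phi : T -> G) w :=
  foldr (fun l g => eval_letter phi l * g) 1 w.

(** The extension of [phi] to a morphism, by the universal property of free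
    groups. *)
Definition free_eval (G : groupType) (phi : T -> G) (x : free_group T) :=
  eval_word phi (word x).

Variables (G : groupType) (phi : T -> G).

Lemma eval_inv_letter l : eval_letter phi (inv_letter l) =
  (eval_letter phi l)^-1.
Proof. by case: l => t [] //=; rewrite /eval_letter /= invgK. Qed.

Lemma eval_push l w : eval_word phi (push l w) =
  eval_letter phi l * eval_word phi w.
Proof.
case: w => //= l' w; case: eqP => [->|//].
by rewrite eval_inv_letter mulVKg.
Qed.

Lemma free_evalM : {morph free_eval phi : x y / x * y}.
Proof.
move=> x y; rewrite /free_eval /=.
elim: (word x) => /= [|l w IHw]; first by rewrite mul1g.
by rewrite eval_push IHw mulgA.
Qed.

Lemma free_eval_gen t : free_eval phi (free_gen t) = phi t.
Proof. by rewrite /free_eval /= mulg1. Qed.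

Lemma free_eval_unique (f : free_group T -> G) :
  {morph f : x y / x * y} -> (forall t, f (free_gen t) = phi t) ->
  f =1 free_eval phi.
Proof.
move=> fM fphi [w rw]; elim: w rw => [|l w IHw] rlw.
  rewrite (_ : FreeGroup rlw = 1); last exact: val_inj.
  by rewrite (morph1 fM).
have rl : reduced [:: l] by [].
have rw := reduced_cons rlw.
have -> : FreeGroup rlw = FreeGroup rl * FreeGroup rw.
  apply: val_inj => /=; move: rlw; case: (w) => //= l' w'.
  by rewrite /reduced /= => /andP[/negbTE ->].
rewrite fM free_evalM IHw; congr (_ * _).
rewrite /free_eval /= mulg1 /eval_letter; case: l rl {rlw} => t [] rl /=;
  last first.
  by rewrite -fphi; congr (f _); exact: val_inj.
rewrite -fphi -(morphV fM); congr (f _); exact: val_inj.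
Qed.

End FreeGroupMorphism.

(** The positive cones of the bi-orderings of the quotient by [N], pulled back to
    [G]. *)
Definition bi_cone (G : groupType) (N C : set G) :=
  [/\ forall x y, C x -> C y -> C (x * y),
      forall x g, C x -> C (x ^ g),
      forall x y, C x -> N y -> C (x * y),
      forall x, N x -> ~ C x &
      forall x, ~ N x -> C x \/ C x^-1].

Lemma bi_orderable_cone (G : groupType) (N : normal_subgroup G) :
  bi_orderable (quotient N) <-> exists C, bi_cone N C.
Proof.
split=> [[lt [irr tr tot inv]]|[C [CM CJ CN NC tot]]].
  exists [set x | lt 1 (coset N x)]; split=> /=.
  - move=> x y x1 y1; rewrite cosetM; apply: tr x1 _.
    by have [+ _] := inv _ _ (coset N x) y1; rewrite mulg1.
  - move=> x g x1; rewrite /conjg !cosetM.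
    have [+ _] := inv _ _ (coset N g^-1) x1;
      rewrite mulg1 => /(inv _ _ (coset N g))[_].
    by rewrite -(@cosetM _ N g^-1 g) mulVg mulgA.
  - by move=> x y x1 /coset_eq1 y1; rewrite cosetM y1 mulg1.
  - by move=> x /coset_eq1 ->; exact: irr.
  - move=> x Nx; have [|//|xN] := tot 1 (coset N x);
      first by move/esym/coset_eq1.
      by left.
    right; have [+ _] := inv _ _ (coset N x^-1) xN.
    by rewrite -(@cosetM _ N x^-1 x) mulVg mulg1.
have CE x y : N (x^-1 * y) -> C x -> C y.
  by move=> Nxy Cx; rewrite -[y](mulVKg x); exact: CN.
pose lt (u v : quotient N) := C ((repr u)^-1 * repr v).
have ltE x y : lt (coset N x) (coset N y) <-> C (x^-1 * y).
  rewrite /lt; set x' := repr _; set y' := repr _.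
  have xx' : coset N x' = coset N x by exact: coset_repr.
  have yy' : coset N y' = coset N y by exact: coset_repr.
  by split; apply: CE; apply/coset_eq;
    rewrite !cosetM !(morphV (@cosetM _ _)) xx' yy'.
exists lt; split.
- by move=> u; rewrite -(coset_repr u) => /ltE; rewrite mulVg; apply: NC;
    exact: normal1.
- move=> u v w; rewrite -(coset_repr u) -(coset_repr v) -(coset_repr w).
  by rewrite !ltE => uv /(CM _ _ uv); rewrite -mulgA mulVKg.
- move=> u v; rewrite -(coset_repr u) -(coset_repr v) !ltE => uv.
  have [|//|] := tot ((repr u)^-1 * repr v); first by move/coset_eq.
    by left.
  by rewrite invgM invgK; right.
- move=> u v w; rewrite -(coset_repr u) -(coset_repr v) -(coset_repr w) -!cosetM
    !ltE.
  move=> uv; split; first by rewrite invgM -mulgA mulKg.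
  by rewrite invgM -mulgA (mulgA _ (repr v)); exact: CJ.
Qed.

(** * The space of finitely generated bi-orderable groups *)

Lemma BO_finite_support (N : BO) : exists n, forall i, (n <= i)%N ->
  val N (free_gen i).
Proof.
have /set_mem[[_ fin] _] := valP N.
have [s sP] := (finite_seqP _).1 fin.
exists (\max_(i <- s) i.+1)%N => i; apply: contraTT => Ni; rewrite -ltnNge.
have : [set i | ~~ val N (free_gen i)] i by [].
by rewrite sP /= => is_; exact: (leq_bigmax_seq (F := succn)).
Qed.

(** The generators beyond the list [u] are sent to the identity. *)
Definition endo (u : seq Finf) : Finf -> Finf := free_eval (fun i => nth 1 u i).

Lemma endoM u : {morph endo u : x y / x * y}. Proof. exact: free_evalM. Qed.

Definition BO_ns (N : BO) : normal_subgroup Finf :=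
  NormalSubgroup (BO_normal N).

(** An isomorphism lifts to an endomorphism of [Finf] that sends to the identity
    every generator beyond the bound for [N], so that a finite list of images
    describes it. *)
Lemma BO_isoP (N M : BO) : BO_iso N M <-> exists u : seq Finf,
  (forall g, val N g <-> val M (endo u g)) /\
  forall g, exists g', val M (g^-1 * endo u g').
Proof.
split=> [[f fbij]|[u [Nu usurj]]].
  have [n nP] := BO_finite_support N.
  pose u := mkseq (fun i => repr (f (coset (BO_ns N) (free_gen i)))) n.
  exists u.
  have fu g : f (coset (BO_ns N) g) = coset (BO_ns M) (endo u g).
    pose phi i := coset (BO_ns M) (endo u (free_gen i)).
    rewrite (@free_eval_unique _ _ phi (fun g => f (coset (BO_ns N) g))).
    - rewrite -(@free_eval_unique _ _ phi (fun g =>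
        coset (BO_ns M) (endo u g))) //.
      by move=> x y; rewrite endoM cosetM.
    - by move=> x y; rewrite cosetM gmulfM.
    - move=> i; rewrite /phi /endo free_eval_gen; have [lin|nli] := ltnP i n.
        by rewrite nth_mkseq // coset_repr.
      rewrite nth_default ?size_mkseq //.
      have /coset_eq1 -> : BO_ns N (free_gen i) by exact: nP.
      exact: (morph1 (@gmulfM _ _ f)).
  split=> g.
    rewrite -[X in X <-> _](coset_eq1 (BO_ns N)) -[X in _ <->
      X](coset_eq1 (BO_ns M)) -fu.
    split=> [->|]; first exact: (morph1 (@gmulfM _ _ f)).
    by rewrite -[RHS](morph1 (@gmulfM _ _ f)) => /(bij_inj fbij).
  have [h _ hK] := fbij.
  exists (repr (h (coset (BO_ns M) g))); apply/(coset_eq (BO_ns M)).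
  by rewrite -fu coset_repr hK.
apply: (@quotient_isomorphic _ _ _ (fun g => coset (BO_ns M) (endo u g))).
- by move=> x y; rewrite endoM cosetM.
- move=> k; have [g' gg'] := usurj (repr k); exists g'.
  by rewrite -(coset_repr k); apply/esym/coset_eq.
- by move=> g; rewrite coset_eq1; exact: Nu.
Qed.

Lemma BO_iso_equivalence : RelationClasses.Equivalence BO_iso.
Proof.
split.
- by move=> N; apply: (@bijective_isomorphic _ _ id) => //; exists id.
- by move=> N M; exact: group_isomorphic_sym.
- by move=> N M K; exact: group_isomorphic_trans.
Qed.

Lemma BO_ext (N M : BO) : (forall g, val N g <-> val M g) -> N = M.
Proof.
by move=> NM; apply/val_inj/funext => g; apply/idP/idP => /NM.
Qed.

Lemma BO_iso_countable (N : BO_space) : countable [set M | BO_iso N M].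
Proof.
have /choice[c cP] (M : BO) : exists u : seq Finf, BO_iso N M ->
    forall g, val M g <-> val N (endo u g).
  have [NM|//] := pselect (BO_iso N M); last by exists [::].
  by have /BO_isoP[u [uP _]] := group_isomorphic_sym NM; exists u.
apply/countable_injP; exists (pickle \o c) => M M' /set_mem NM /set_mem NM' /=.
move=> /(pcan_inj pickleK) cM; apply: BO_ext => g.
by rewrite (cP M NM) cM (cP M' NM').
Qed.

Lemma coordinate_open (g : Finf) b : open [set N : powerset_space | N g = b].
Proof.
have o : open [set b] by exact: discrete_open.
exact ((@continuousP powerset_space bool (fun N =>
  N g)).1 (@proj_continuous Finf (fun=> bool) g) [set b] o).
Qed.

Lemma measurable_coordinate (g : Finf) (b : bool) :
  measurable [set N : BO_space | val N g = b].
Proof.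
exists [set N : powerset_space | N g = b]; last by rewrite setTI.
by apply: sub_gen_smallest; exact: coordinate_open.
Qed.

Lemma BO_iso_measurable : measurable [set p : BO_space * BO_space |
  BO_iso p.1 p.2].
Proof.
have m1 g : measurable (fun p : BO_space * BO_space => val p.1 g = true).
  rewrite -[X in measurable X]setTI.
  exact: (@measurable_fst _ _ BO_space BO_space) _
    (measurable_coordinate g true).
have m2 g : measurable (fun p : BO_space * BO_space => val p.2 g = true).
  rewrite -[X in measurable X]setTI.
  exact: (@measurable_snd _ _ BO_space BO_space) _
    (measurable_coordinate g true).
rewrite (_ : mkset _ = fun p : BO_space * BO_space => exists u : seq Finf,
    (forall g, val p.1 g <-> val p.2 (endo u g)) /\
    forall g, exists g', val p.2 (g^-1 * endo u g')); last first.
  by apply/seteqP; split=> p /BO_isoP.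
apply: measurable_exists => u; apply: measurable_and.
  by apply: measurable_forall => g; apply: measurable_iff;
    [exact: m1|exact: m2].
by apply: measurable_forall => g; apply: measurable_exists => g'; exact: m2.
Qed.

(** A basic open set of the product constrains finitely many coordinates. *)
Lemma powerset_open_agree (U : set powerset_space) N : open U -> U N ->
  exists n, forall N', (forall g, (pickle g < n)%N -> N g = N' g) -> U N'.
Proof.
move=> oU UN.
pose V n := [set N' : powerset_space | forall g : Finf, (pickle g < n)%N ->
  N g = N' g].
pose F := filter_from [set: nat] V.
have FF : Filter F.
  apply: filter_from_filter; first by exists 0%N.
  move=> n m _ _; exists (maxn n m) => // N' NN'.
  by split=> g gn; apply: NN'; rewrite leq_max gn ?orbT.
have FN : F --> (N : powerset_space).
  apply/cvg_sup => g A /= [_ [[B oB <-] BN sub]].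
  exists (pickle g).+1 => // N' NN'; apply: sub => /=.
  by rewrite /proj -NN'.
have [n _ Vn] : F U by apply: FN; exact: open_nbhs_nbhs.
by exists n => N' NN'; exact: Vn.
Qed.

Definition coordinates : set (set powerset_space) :=
  [set A | exists g, A = [set N : powerset_space | N g]].

Lemma open_coordinates (U : set powerset_space) : open U ->
  <<s coordinates >> U.
Proof.
move=> oU; pose T := g_sigma_algebraType coordinates.
rewrite (_ : U = fun N => exists p : nat * seq Finf,
  (forall N' : powerset_space,
   (forall g, (pickle g < p.1)%N -> N' g = (g \in p.2)) -> U N') /\
   forall g, (pickle g < p.1)%N -> N g = (g \in p.2)).
  apply: (@measurable_exists _ T) => p; apply: (@measurable_and _ T).
    exact: (@measurable_prop _ T).
  apply: (@measurable_forall _ T) => g; apply: (@measurable_imply _ T).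
    exact: (@measurable_prop _ T).
  have mg : @measurable _ T [set N : powerset_space | N g] by apply:
    sub_gen_smallest; exists g.
  case: (g \in p.2) => //; rewrite (_ : (fun x => _) =
    ~` [set N : powerset_space | N g]).
    exact: measurableC.
  by apply/seteqP; split=> N /= => [->|/negP/negbTE].
apply/seteqP; split=> N; last by case=> p [pU Np]; exact: pU.
move=> UN; have [n nU] := powerset_open_agree oU UN.
pose s := [seq g <- pmap (@pickle_inv Finf) (iota 0 n) | N g].
have Ns g : (pickle g < n)%N -> N g = (g \in s).
  move=> gn; rewrite mem_filter mem_pmap; case: (N g) => //=.
  by apply/esym/mapP; exists (pickle g); rewrite ?mem_iota ?pickleK_inv.
by exists (n, s); split=> //= N' N's; apply: nU => g gn; rewrite Ns // N's.
Qed.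

Lemma borel_coordinates (B : set (borel_space powerset_space)) :
  measurable B -> <<s coordinates >> B.
Proof.
move: B; apply: smallest_sub; first exact: smallest_sigma_algebra.
by move=> U oU; exact: open_coordinates.
Qed.

Lemma BO_bound_exists (N : BO) :
  exists n, `[< forall i, (n <= i)%N -> val N (free_gen i) >].
Proof. by have [n nN] := BO_finite_support N; exists n; exact/asboolP. Qed.

Definition BO_bound (N : BO) := ex_minn (BO_bound_exists N).

(** The first entry is the bound beyond which all the generators lie in [N].
    Without it, a limit of points could lose almost all the generators. *)
Definition BO_code (N : BO) (i : nat) : nat := if i is i.+1 then
    if @pickle_inv Finf i is Some g then val N g else 0%N
  else BO_bound N.

Lemma BO_code_val N g : BO_code N (pickle g).+1 = val N g.
Proof. by rewrite /BO_code pickleK_inv. Qed.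

Lemma BO_code_inj : injective BO_code.
Proof.
move=> N M NM; apply: BO_ext => g.
by have := congr1 (fun z => z (pickle g).+1) NM; rewrite !BO_code_val;
  case: (val N g); case: (val M g).
Qed.

Lemma BO_boundP N n : BO_bound N = n <->
  (forall i, (n <= i)%N -> val N (free_gen i)) /\
  forall k, n = k.+1 -> val N (free_gen k) = false.
Proof.
rewrite /BO_bound; case: ex_minnP => m /asboolP mN mmin; split=> [<-|[nN nk]].
  split=> // k mk; apply/negP => Nk;
    have /mmin : `[< forall i, (k <= i)%N -> val N (free_gen i) >].
    apply/asboolP => i; rewrite leq_eqVlt => /predU1P[<-//|ki].
    by apply: mN; rewrite mk.
  by rewrite mk ltnn.
apply/eqP; rewrite eqn_leq mmin; last exact/asboolP.
case: n nk nN => // k /(_ _ erefl) Nk _; rewrite ltnNge; apply/negP => mk.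
by rewrite mN in Nk.
Qed.

Lemma measurable_BO_code i k : measurable [set N : BO_space | BO_code N i = k].
Proof.
case: i => [|i] /=; last first.
  case: pickle_inv => [g|]; last exact: measurable_prop.
  rewrite (_ : mkset _ = fun N => forall b : bool, val N g = b -> b = k :> nat).
    apply: measurable_forall => b; apply: measurable_imply;
      last exact: measurable_prop.
    exact: measurable_coordinate.
  by apply/seteqP; split=> N /= => [<- b ->|/(_ _ erefl)].
rewrite (_ : mkset _ = fun N : BO_space =>
  (forall i, (k <= i)%N -> val N (free_gen i) = true) /\
  forall j, k = j.+1 -> val N (free_gen j) = false); last first.
  by apply/seteqP; split=> N /BO_boundP.
apply: measurable_and; apply: measurable_forall => i.
  apply: measurable_imply; [exact: measurable_prop|exact:
    measurable_coordinate].
apply: measurable_imply; [exact: measurable_prop|exact: measurable_coordinate].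
Qed.

Section BOLimit.
Variables (N : nat -> BO) (L : powerset_space).
Hypothesis NL : forall g, \forall n \near \oo, val (N n) g = L g.

Lemma BO_limit_transfer (g : Finf) b : L g = b -> \forall n \near \oo,
  val (N n) g = b.
Proof. by move=> <-. Qed.

Lemma BO_limit_normal : is_normal_subgroup [set g | L g].
Proof.
have ns n := BO_normal (N n); split; first split.
- have [n L1] := filter_ex (NL 1); rewrite /= -L1.
  by have [[]] := ns n.
- move=> x y /BO_limit_transfer Nx /BO_limit_transfer Ny.
  have [n [xyn [xn yn]]] := filter_ex (filterI (NL (x / y)) (filterI Nx Ny)).
  by rewrite /= -xyn; have [[_ +] _] := ns n; apply.
- move=> x g /BO_limit_transfer Nx.
  have [n [xgn xn]] := filter_ex (filterI (NL (x ^ g)) Nx).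
  by rewrite /= -xgn; have [_] := ns n; apply.
Qed.

(** An ultrafilter selects a positive cone for the limit from positive cones for
    the points of the sequence. *)
Lemma BO_limit_cone : exists C, bi_cone [set g | L g] C.
Proof.
have /choice[C CP] n : exists C, bi_cone [set g | val (N n) g] C.
  have /set_mem[_ [hN /bi_orderable_cone[C CP]]] := valP (N n).
  by exists C.
have [G [GU ooG]] := ultraFilterLemma eventually_filter.
have GF : ProperFilter G by exact: ultra_proper.
exists [set g | G [set n | C n g]]; split=> /=.
- move=> x y Cx Cy; apply: filterS (filterI Cx Cy) => n [xn yn] /=.
  by have [+ _ _ _ _] := CP n; apply.
- move=> x g Cx; apply: filterS Cx => n xn /=.
  by have [_ + _ _ _] := CP n; apply.
- move=> x y Cx /BO_limit_transfer/ooG Ny;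
    apply: filterS (filterI Cx Ny) => n [xn yn] /=.
  by have [_ _ + _ _] := CP n; apply.
- move=> x /BO_limit_transfer/ooG Nx Cx.
  have [n [xn nx]] := filter_ex (filterI Cx Nx).
  by have [_ _ _ /(_ x nx) + _] := CP n; apply.
- move=> x /negP/negbTE/BO_limit_transfer/ooG Nx.
  have [|nCx] := in_ultra_setVsetC [set n | C n x] GU; first by left.
  right; apply: filterS (filterI nCx Nx) => n [xn /= nx].
  have [_ _ _ _ tot] := CP n; have [|//|] := tot x; last by [].
  by rewrite /= nx.
Qed.

Lemma BO_limit k : (forall n, BO_bound (N n.+1) = k) ->
  exists M : BO, val M = L /\ BO_bound M = k.
Proof.
move=> Nk; have Lk i : (k <= i)%N -> L (free_gen i).
  move=> ki; have [m _ mL] := NL (free_gen i).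
  have /BO_boundP[Nm _] := Nk m; rewrite -(mL m.+1 (leqnSn m)).
  exact: Nm.
have LBO : L \in BO_set.
  apply/mem_set; split.
    split; first exact: BO_limit_normal.
    apply: (@sub_finite_set _ _ `I_k); last exact: finite_II.
    move=> i /= nLi; rewrite ltnNge; apply/negP => /Lk; exact/negP.
  exists BO_limit_normal; apply/bi_orderable_cone; exact: BO_limit_cone.
exists (exist _ L LBO : BO); split=> //; apply/BO_boundP; split=> // j kj /=.
have [m _ mL] := NL (free_gen j).
have /BO_boundP[_ /(_ _ kj)] := Nk m; by rewrite (mL m.+1 (leqnSn m)).
Qed.

End BOLimit.

Lemma BO_code_closed : code_closed BO_code.
Proof.
move=> z /choice[N zN].
pose L : powerset_space := fun g => z (pickle g).+1 != 0%N.
have zL n g : ((pickle g).+2 <= n)%N -> z (pickle g).+1 = val (N n) g.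
  by move=> gn; rewrite (zN n) // BO_code_val.
have [g|n|M [ML Mk]] := @BO_limit N L _ (z 0%N).
- exists (pickle g).+2 => // n gn; rewrite /mkset /L (zL n) //.
  by case: (val (N n) g).
- by rewrite (zN n.+1 0%N).
exists M; apply/funext => -[|i] //=; case gi: pickle_inv => [g|].
  have <- : pickle g = i by have /= := @pickle_invK Finf i; rewrite gi.
  rewrite ML /L (zL (pickle g).+2) //; by case: (val (N (pickle g).+2) g).
by rewrite (zN i.+2) //= gi.
Qed.

Lemma BO_standard_borel (R : realType) : standard_borel R BO_space.
Proof.
apply: (@standard_borel_code _ _ BO_space BO_code BO_code_inj BO_code_closed).
  exact: measurable_BO_code.
set D := [set A | _]; pose T := g_sigma_algebraType D.
move=> _ [B mB <-]; rewrite setTI.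
apply: (measurable_preimage_generated (T := T)) (borel_coordinates mB).
move=> _ [g ->]; apply: sub_gen_smallest; exists (pickle g).+1, 1%N.
apply/seteqP; split=> N; rewrite /preimage /mkset BO_code_val;
  first by move=> ->.
by case: (val N g).
Qed.

Lemma BO_iso_cber (R : realType) : countable_borel_equivalence R BO_iso.
Proof.
split.
- exact: BO_standard_borel.
- exact: BO_iso_equivalence.
- exact: BO_iso_measurable.
- exact: BO_iso_countable.
Qed.

(** * Centralizers and an induced action of a free group *)

Section FreeGroupWords.
Variables (T : choiceType).
Implicit Types (l : T * bool) (u v w : seq (T * bool)) (x y h : free_group T).

Definition free_letter l : free_group T := @FreeGroup T [:: l] isT.

Lemma free_cons l w (rlw : reduced (l :: w)) :
  FreeGroup rlw = free_letter l * FreeGroup (reduced_cons rlw).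
Proof.
apply: val_inj => /=; case: w rlw => //= l' w'.
by rewrite /reduced /= => /andP[/negbTE ->].
Qed.

Lemma free_letterV l : free_letter (inv_letter l) = (free_letter l)^-1.
Proof.
by apply: (mulgI (free_letter l)); rewrite mulgV; apply: val_inj;
  rewrite /= eqxx.
Qed.

Lemma commute_letters b s s' : commute (free_letter (b, s)) (free_letter (b,
  s')).
Proof.
have inv : free_letter (b, true) = (free_letter (b, false))^-1 by exact:
  (free_letterV (b, false)).
by case: s; case: s'; rewrite ?inv /commute ?mulVg ?mulgV.
Qed.

(** A product of reduced words is as long as its factors together only if
    nothing cancels. *)
Lemma foldr_push_size u v : (size (foldr (@push T) v u) <= size u + size v)%N /\
  (size (foldr (@push T) v u) = (size u + size v)%N ->
    foldr (@push T) v u = u ++ v).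
Proof.
elim: u => //= l u [IHle IHeq]; set X := foldr _ _ _ in IHle IHeq *.
have [le eq] : (size (push l X) <= (size X).+1)%N /\
    (size (push l X) = (size X).+1 -> push l X = l :: X).
  case: X {IHle IHeq} => //= l' X; case: ifP => //= _; split;
    first by rewrite ltnW.
  by move=> /eqP; rewrite -[X in X == _]addn0 -addn2 eqn_add2l.
split=> [|eqs]; first by rewrite (leq_trans le) // addSn ltnS.
have sX : size X = (size u + size v)%N.
  by apply/eqP; rewrite eqn_leq IHle -ltnS -addSn -eqs.
by rewrite -IHeq // eq // eqs sX.
Qed.

Definition headed (b : T) w := if w is l :: _ then l.1 == b else false.

Lemma word_pow_mul b s k x : ~~ headed b (word x) ->
  word (free_letter (b, s) ^+ k * x) = nseq k (b, s) ++ word x.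
Proof.
move=> hx; elim: k => [|k IHk]; first by rewrite expg0 mul1g.
rewrite expgS -mulgA /= [foldr _ _ _]IHk; case: k {IHk} => [|k] /=.
  case: (word x) hx => //= l w lb; case: eqP => // ll; case/negP: lb.
  by rewrite ll.
by case: eqP => // -[]; case: (s).
Qed.

Lemma strip_prefix b x : exists u v : free_group T,
  [/\ x = u * v, ~~ headed b (word v) &
  exists w, all (fun l => l.1 == b) w /\ u = \prod_(l <- w) free_letter l].
Proof.
case: x => w; elim: w => [|l w IHw] rw.
  exists 1, 1; split=> //; first by rewrite mulg1; exact: val_inj.
  by exists [::]; rewrite big_nil.
have [lb|lb] := boolP (l.1 == b); last first.
  exists 1, (FreeGroup rw); split=> //; first by rewrite mul1g.
  by exists [::]; rewrite big_nil.
have [u [v [xuv hv [w' [w'b uw']]]]] := IHw (reduced_cons rw).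
exists (free_letter l * u), v; split=> //; first by rewrite free_cons xuv mulgA.
by exists (l :: w'); rewrite /= lb big_cons uw'.
Qed.

(** Strip from [h] its longest prefix of letters [b]. The rest [v] still commutes
    with the power [B]. No letter cancels in [B * v], so that [B * v] and [v * B]
    have the maximal length and both are concatenations: if [v] were not empty,
    its first letter would be that of [B]. *)
Lemma centralizer_pow b s k h : commute h (free_letter (b, s) ^+ k.+1) ->
  exists w, all (fun l => l.1 == b) w /\ h = \prod_(l <- w) free_letter l.
Proof.
set B := _ ^+ _; have [u [v [-> hv [w [wb uw]]]]] := strip_prefix b h => hB.
have uB : commute u B.
  rewrite uw; elim: w wb {uw} => [_|[t s'] w IHw /= /andP[/eqP tb /IHw wB]].
    by rewrite big_nil /commute mul1g mulg1.
  have lB : commute (free_letter (t, s')) B by rewrite tb;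
    apply/commuteX/commute_letters.
  by rewrite big_cons; apply/commute_sym/commuteM; exact: commute_sym.
have vB : v * B = B * v.
  by apply: (mulgI u); rewrite !mulgA hB uB mulgA.
have Bv : word (B * v) = nseq k.+1 (b, s) ++ word v by exact: word_pow_mul.
have wB : word B = nseq k.+1 (b, s).
  by rewrite -[B]mulg1 word_pow_mul //= cats0.
have := (foldr_push_size (word v) (word B)).2.
rewrite -[foldr _ _ _]/(word (v * B)) vB Bv wB size_cat addnC => /(_ erefl).
case wv: (word v) hv => [|l w'] /=;
  last by move=> /negP lb [] /(congr1 fst) /= /esym/eqP.
move=> _ _; exists w; split=> //; rewrite uw.
by rewrite (_ : v = 1) ?mulg1 //; exact: val_inj.
Qed.

End FreeGroupWords.

Section InducedAction.
Variables (T : choiceType) (a b : T) (Y : Type) (s : nat -> Y -> Y).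
Hypothesis sK : forall n, involutive (s n).
Implicit Types (p : int * Y) (l : T * bool).

(** The action induced from level 0: the conjugate of [a] by the [n]-th power of
    [b] acts there by [s n]. As [s n] is an involution, [a] and its inverse act
    in the same way. *)
Definition act_letter l p : int * Y :=
  if l.1 == b then (if l.2 then (p.1 - 1)%R else (p.1 + 1)%R, p.2)
  else if l.1 == a then (p.1, if p.1 is Posz n then s n p.2 else p.2)
  else p.

Definition act (x : free_group T) p := foldr act_letter p (word x).

Lemma act_letterK l : cancel (act_letter l) (act_letter (inv_letter l)).
Proof.
move=> [n y]; rewrite /act_letter /=.
case: (l.1 == b) => /=; first by case: l.2; rewrite /= ?subrK ?addrK.
by case: (l.1 == a) => //=; case: n => //= n; rewrite sK.
Qed.

Lemma actM x y p : act (x * y) p = act x (act y p).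
Proof.
rewrite /act /=; elim: (word x) => //= l u <-.
case: (foldr _ _ u) => //= l' w; case: eqP => [->|//] /=.
by rewrite -{1}(inv_letterK l) act_letterK.
Qed.

Lemma act1 p : act 1 p = p. Proof. by []. Qed.

Lemma actK x : cancel (act x) (act x^-1).
Proof. by move=> p; rewrite -actM mulVg. Qed.

Definition degree_letter l : int :=
  if l.1 == b then (if l.2 then -1 else 1)%R else 0%R.

Definition degree_word (w : seq (T * bool)) : int :=
  (\sum_(l <- w) degree_letter l)%R.

Lemma act_degree (w : seq (T * bool)) p :
  (foldr act_letter p w).1 = (degree_word w + p.1)%R.
Proof.
rewrite /degree_word; elim: w => [|l w IHw] /=; first by rewrite big_nil add0r.
rewrite big_cons -addrA -IHw /degree_letter /act_letter.
case: eqP => _; first by case: l.2; rewrite /= addrC.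
by case: eqP; rewrite add0r.
Qed.

Lemma act_fst x p : (act x p).1 = (degree_word (word x) + p.1)%R.
Proof. exact: act_degree. Qed.

Lemma act_pow_letter sg k p :
  act (free_letter (b, sg) ^+ k) p = ((if sg then p.1 - k%:Z else p.1 + k%:Z)%R,
    p.2).
Proof.
elim: k => [|k IHk].
  by rewrite expg0 act1; case: p => n y; case: sg; congr (_, _) => /=; lia.
rewrite expgS actM IHk /act /= /act_letter /= eqxx.
by case: sg {IHk} => /=; congr (_, _); lia.
Qed.

Lemma act_prod_b w p : all (fun l => l.1 == b) w ->
  (act (\prod_(l <- w) free_letter l) p).2 = p.2.
Proof.
elim: w => [|l w IHw] /=; first by rewrite big_nil act1.
case/andP=> lb /IHw wp; rewrite big_cons actM /act /= /act_letter lb /=.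
exact: wp.
Qed.

(** Comparing degrees in [b] gives the equality of the exponents; then [h] lies
    in the centralizer of a power of [b], so it is a power of [b] and moves the
    level only. *)
Lemma conjugate_pow sg i j h (y0 : Y) :
  h * free_letter (b, sg) ^+ i.+1 * h^-1 = free_letter (b, sg) ^+ j.+1 ->
  i = j /\ forall p, (act h^-1 p).2 = p.2.
Proof.
set B := free_letter _ => hB; have hB' : h * B ^+ i.+1 = B ^+ j.+1 * h.
  by rewrite -hB mulgVK.
have ij : i = j.
  have := congr1 (fun x => (act x (0%R, y0)).1) hB'.
  by rewrite !actM !act_pow_letter !act_fst; case: (sg) => /=; lia.
split=> // p; rewrite ij in hB'.
have [w [wb hw]] := centralizer_pow hB'.
have [q ->] : exists q, p = act h q by exists (act h^-1 p);
  rewrite -{1}(invgK h) actK.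
by rewrite actK hw act_prod_b.
Qed.

End InducedAction.

(** * Central subgroups and kernels *)

Section GeneratedProducts.
Variables (I : choiceType) (H : groupType) (a : I -> H).
Implicit Types (S : set I) (w : seq (I * bool)).

Definition word_prod w : H := \prod_(p <- w) eval_letter a p.

Lemma word_prod_cat w w' : word_prod (w ++ w') = word_prod w * word_prod w'.
Proof. exact: big_cat. Qed.

Lemma word_prodV w : (word_prod w)^-1 =
  word_prod (rev [seq (p.1, ~~ p.2) | p <- w]).
Proof.
elim: w => [|[i b] w IHw]; first by rewrite /word_prod !big_nil invg1.
rewrite /= rev_cons -cats1 word_prod_cat -IHw /word_prod big_cons big_seq1
  invgM.
by case: b; rewrite /eval_letter /= ?invgK.
Qed.

Lemma generatedP S x : generated (a @` S) x <->
  exists w, (forall p, p \in w -> S p.1) /\ x = word_prod w.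
Proof.
split=> [gx|[w [wS ->]] B [[B1 BM] aSB]]; last first.
  have BV y : B y -> B y^-1 by move=> By; rewrite -[y^-1]mul1g; exact: BM.
  elim: w wS => [|[i b] w IHw] wS; first by rewrite /word_prod big_nil.
  have Bai : B (a i) by apply: aSB; exists i => //; apply: (wS (i, b));
    rewrite mem_head.
  rewrite /word_prod big_cons -[X in _ * X]invgK; apply: BM.
    by case: b {wS} => /=; [exact: BV|].
  by apply: BV; apply: IHw => p pw; apply: wS; rewrite inE pw orbT.
apply: (gx [set x | exists w, (forall p, p \in w -> S p.1) /\ x = word_prod w]).
split=> [|_ [i Si <-]]; last first.
  exists [:: (i, false)]; split; last by rewrite /word_prod big_seq1.
  by move=> p; rewrite inE => /eqP ->.
split; first by exists [::]; rewrite /word_prod big_nil.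
move=> y z [w [wS ->]] [w' [w'S ->]].
exists (w ++ rev [seq (p.1, ~~ p.2) | p <- w']);
  rewrite word_prod_cat -word_prodV.
split=> // p; rewrite mem_cat mem_rev => /orP[/wS //|/mapP[q qw' ->] /=].
exact: w'S.
Qed.

Lemma expgzD1 (x : H) (n : int) : expgz x (n + 1)%R = expgz x n * x.
Proof.
case: n => [n|[|n]].
- by rewrite (_ : (Posz n + 1)%R = Posz n.+1) ?/= ?expgSr //; lia.
- by rewrite (_ : (Negz 0 + 1)%R = Posz 0) //= expg1 mulVg.
rewrite (_ : (Negz n.+1 + 1)%R = Negz n) /=; last by lia.
by rewrite [in RHS]expgS invgM mulgVK.
Qed.

Lemma expgzB1 (x : H) (n : int) : expgz x (n - 1)%R = expgz x n * x^-1.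
Proof. by rewrite -{2}(subrK 1%R n) expgzD1 mulgK. Qed.

(** As the factors are central, they can be collected one at a time. *)
Lemma word_prod_reduced S w : (forall i, S i -> centre (a i)) ->
  (forall p, p \in w -> S p.1) -> exists (s : seq I) (n : I -> int),
  [/\ uniq s, forall i, i \in s -> S i &
      word_prod w = \prod_(i <- s) expgz (a i) (n i)].
Proof.
move=> ac; elim: w => [|[i b] w IHw] wS.
  by exists [::], (fun=> 0%R); rewrite /word_prod !big_nil.
have Si : S i by apply: (wS (i, b)); rewrite mem_head.
have [p pw|s [n [us sS wE]]] := IHw; first by apply: wS; rewrite inE pw orbT.
rewrite /word_prod big_cons -/(word_prod w) wE.
pose d : int := if b then (-1)%R else 1%R.
have liE n' : expgz (a i) (n' + d)%R = expgz (a i) n' * eval_letter a (i, b).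
  by rewrite /d /eval_letter; case: b {wS d}; rewrite /= ?expgzB1 ?expgzD1.
have lc y : commute (eval_letter a (i, b)) y.
  rewrite /eval_letter; case: b {wS d liE} => /=; last exact: ac.
  by apply/commute_sym/commuteV/commute_sym; exact: ac.
pose m k := if k == i then ((if i \in s then n i else 0) + d)%R else n k.
have mE s' : i \notin s' -> \prod_(k <- s') expgz (a k) (m k) =
  \prod_(k <- s') expgz (a k) (n k).
  move=> is'; apply: eq_big_seq => k ks'; rewrite /m; case: eqP => // ki.
  by rewrite -ki ks' in is'.
have [is_|nis] := boolP (i \in s).
  exists s, m; split=> //; have mi : m i = (n i + d)%R by rewrite /m eqxx is_.
  case/splitPr: is_ us => s1 s2; rewrite cat_uniq /= negb_or =>
    /and3P[_ /andP[is1 _] /andP[is2 _]].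
  rewrite !big_cat !big_cons /= !mE // mi liE mulgA lc -!mulgA.
  by rewrite (mulgA (eval_letter a (i, b))) lc -!mulgA.
exists (i :: s), m; split; first by rewrite /= nis.
  by move=> k; rewrite inE => /predU1P[->|/sS].
rewrite big_cons mE // /m eqxx (negbTE nis) add0r; congr (_ * _).
by have := liE 0%R; rewrite add0r /= mul1g.
Qed.

Lemma free_generated_mem P S i : free_abelian_family P a ->
  (forall j, P j -> centre (a j)) -> S `<=` P -> P i ->
  generated (a @` S) (a i) -> S i.
Proof.
move=> afree ac SP Pi /generatedP[w [wS aw]].
have [j Sj|s [n [us sS wE]]] := word_prod_reduced _ wS; first exact/ac/SP.
apply: contrapT => nSi; have nis : i \notin s by apply/negP => /sS.
pose m k : int := if k == i then (-1)%R else n k.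
have mi : m i = (-1)%R by rewrite /m eqxx.
suff /(_ i) : forall k, k \in rcons s i ->
  m k = 0%R by rewrite mem_rcons mem_head mi => /(_ isT).
apply: afree; first by rewrite rcons_uniq nis us.
  by move=> k; rewrite mem_rcons inE => /predU1P[->//|/sS/SP].
rewrite -cats1 big_cat big_seq1 mi /= expg1.
rewrite [X in X / _](_ : _ = a i) ?mulgV //.
rewrite aw wE; apply: eq_big_seq => k ks; rewrite /m; case: eqP => // ki.
by rewrite -ki ks in nis.
Qed.

End GeneratedProducts.

(** A finitely generated group is the quotient of [Finf] by a normal subgroup that
    contains almost all the generators. *)
Lemma Finf_surjection (G : groupType) : finitely_generated G ->
  exists psi : Finf -> G, [/\ {morph psi : x y / x * y},
    forall x, exists g, psi g = x &
    exists n, forall i, (n <= i)%N -> psi (free_gen i) = 1].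
Proof.
case=> A /finite_seqP[s As] genA.
pose psi := free_eval (fun i => nth (1 : G) s i).
have psiM : {morph psi : x y / x * y} by exact: free_evalM.
exists psi; split=> // [x|].
  have gx : generated A x by rewrite genA.
  suff [g _ gy] : range psi x by exists g.
  apply: (gx (range psi)); split=> [|y]; first split.
  - by exists 1 => //; exact: (morph1 psiM).
  - move=> _ _ [g _ <-] [h _ <-]; exists (g * h^-1) => //.
    by rewrite psiM (morphV psiM).
  - rewrite As /= => ys; exists (free_gen (index y s)) => //.
    by rewrite /psi free_eval_gen nth_index.
by exists (size s) => i si; rewrite /psi free_eval_gen nth_default.
Qed.

Lemma bi_orderable_isomorphic (G K : groupType) :
  group_isomorphic G K -> bi_orderable K -> bi_orderable G.
Proof.
case=> f fbij [lt [irr tr tot inv]]; exists (fun x y => lt (f x) (f y)); split.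
- by move=> x; exact: irr.
- by move=> x y z; exact: tr.
- by move=> x y xy; apply: tot => /(bij_inj fbij).
- by move=> x y z xy; rewrite !gmulfM; exact: inv.
Qed.

Section KernelCoding.
Variables (H : groupType) (psi : Finf -> H).
Hypothesis psiM : {morph psi : x y / x * y}.
Hypothesis psi_surj : forall x, exists g, psi g = x.
Hypothesis psi_finite : exists n, forall i, (n <= i)%N -> psi (free_gen i) = 1.
Variable N : normal_subgroup H.

Definition preimage_char : powerset_space := fun g => `[< N (psi g) >].

Lemma preimage_normal : is_normal_subgroup [set g | preimage_char g].
Proof.
split; first split.
- by apply/asboolP; rewrite (morph1 psiM); exact: normal1.
- move=> x y /asboolP Nx /asboolP Ny; apply/asboolP.
  by rewrite psiM (morphV psiM); apply: normalM => //; exact: normalV.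
- move=> x g /asboolP Nx; apply/asboolP.
  by rewrite /conjg !psiM (morphV psiM); exact: (normalJ (psi g) Nx).
Qed.

Lemma preimage_isomorphic (hN : is_normal_subgroup [set g | preimage_char g]) :
  group_isomorphic (quotient (NormalSubgroup hN)) (quotient N).
Proof.
apply: (@quotient_isomorphic _ _ _ (fun g => coset N (psi g))).
- by move=> x y; rewrite psiM cosetM.
- move=> k; have [g gk] := psi_surj (repr k).
  by exists g; rewrite gk coset_repr.
- by move=> g; rewrite coset_eq1; split=> /asboolP.
Qed.

Hypothesis N_orderable : bi_orderable (quotient N).

Lemma preimage_BO : preimage_char \in BO_set.
Proof.
apply/mem_set; split.
  split; first exact: preimage_normal.
  have [n nP] := psi_finite; apply: (@sub_finite_set _ _ `I_n);
    last exact: finite_II.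
  move=> i /= Ni; rewrite ltnNge; apply/negP => /nP psii; apply/negP: Ni.
  by rewrite negbK; apply/asboolP; rewrite psii; exact: normal1.
exists preimage_normal; exact: bi_orderable_isomorphic (preimage_isomorphic _)
  N_orderable.
Qed.

Definition preimage_point : BO_space := exist _ preimage_char preimage_BO.

Lemma preimage_pointE g : val preimage_point g <-> N (psi g).
Proof. by split=> /asboolP. Qed.

Lemma BO_group_preimage : group_isomorphic (BO_group preimage_point)
  (quotient N).
Proof. exact: preimage_isomorphic. Qed.

End KernelCoding.

(** * The reduction *)

Lemma free_group_abelian (T : choiceType) : (forall a b : T, a = b) ->
  abelian_group (free_group T).
Proof.
move=> T1; have letters l (x : free_group T) : commute (free_letter l) x.
  case: x => w; elim: w => [|l' w IHw] rw.
    by rewrite (_ : FreeGroup rw = 1); [exact: commute1|exact: val_inj].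
  rewrite free_cons; apply: commuteM; last exact: IHw.
  by case: l l' {rw IHw} => t s [t' s']; rewrite (T1 t t');
    exact: commute_letters.
case=> w; elim: w => [|l w IHw] rw y.
  rewrite (_ : FreeGroup rw = 1); last exact: val_inj.
  exact/commute_sym/commute1.
rewrite free_cons; apply/commute_sym/commuteM; apply: commute_sym.
  exact: letters.
exact: IHw.
Qed.

Lemma positive_conj (F : groupType) (lt : F -> F -> Prop) g h :
  bi_ordering lt -> lt 1 g -> lt 1 (h * g * h^-1).
Proof.
case=> _ _ _ inv g1; have [+ _] := inv _ _ h g1.
by rewrite mulg1 => /(inv _ _ h^-1)[_]; rewrite mulgV.
Qed.

Lemma positive_exp (F : groupType) (lt : F -> F -> Prop) g n :
  bi_ordering lt -> lt 1 g -> lt 1 (g ^+ n.+1).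
Proof.
case=> _ tr _ inv g1; elim: n => [|n IHn]; first by rewrite expg1.
rewrite expgS; apply: tr g1 _.
by have [+ _] := inv _ _ g IHn; rewrite mulg1.
Qed.

Section ConjugationCode.
Variables (F : groupType) (lt : F -> F -> Prop) (T : choiceType).
Variable phi : {multiplicative free_group T -> F}.
Hypothesis lt_bi : bi_ordering lt.
Hypothesis phi_bij : bijective phi.
Variables (a b : T) (sg : bool) (Y : Type) (e : Y -> cantor) (s : nat -> Y ->
  Y).
Hypothesis ab : a != b.
Hypothesis b_pos : lt 1 (phi (free_letter (b, sg))).
Hypothesis sK : forall n, involutive (s n).

Local Notation B := (free_letter (b, sg)).
Local Notation act := (act a b s).

(** Using all conjugators makes the code equivariant ([conj_code_act]); the
    trivial conjugator records the digits of [p] itself ([conj_codeE]). *)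
Definition conj_code (p : int * Y) : set F :=
  [set g | exists h i, g = phi (h * B ^+ i.+1 * h^-1) /\ e (act h^-1 p).2 i].

Let phi1 := morph1 (@gmulfM _ _ phi).
Let phiV := morphV (@gmulfM _ _ phi).

Lemma conj_code_positive p : conj_code p `<=` positive_cone lt.
Proof.
move=> _ [h [i [-> _]]]; rewrite /positive_cone /= !gmulfM phiV.
apply: positive_conj => //.
have -> : phi (B ^+ i.+1) = phi B ^+ i.+1.
  elim: (i.+1) => [|k IHk]; first by rewrite !expg0 phi1.
  by rewrite !expgS gmulfM IHk.
exact: positive_exp.
Qed.

Lemma conj_code_act k p :
  conj_code (act k p) = [set phi k * g * (phi k)^-1 | g in conj_code p].
Proof.
apply/seteqP; split=> [_ [h [i [-> ei]]]|_ [_ [h [i [-> ei]]] <-]].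
  exists (phi ((k^-1 * h) * B ^+ i.+1 * (k^-1 * h)^-1)).
    by exists (k^-1 * h), i; split=> //; rewrite invgM invgK actM.
  by rewrite -phiV -!gmulfM invgM invgK !mulgA mulgV mul1g mulgK.
exists (k * h), i; split; last by rewrite invgM actM // actK.
by rewrite -phiV -!gmulfM invgM !mulgA.
Qed.

Lemma conj_codeE p i : conj_code p (phi (B ^+ i.+1)) <-> e p.2 i.
Proof.
split=> [[h [j [/(bij_inj phi_bij) hB]]]|ei]; last first.
  by exists 1, i; split; rewrite ?invg1 ?mul1g ?mulg1.
by have [-> ->] := conjugate_pow a sK p.2 (esym hB).
Qed.

(** Climb to level [n] by a power of [b], apply [a] there, and climb down. *)
Lemma conj_code_move n y : exists k, act k (0%R, y) = (0%R, s n y).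
Proof.
pose Bf := free_letter (b, false).
exists (Bf ^- n * (free_letter (a, false) * Bf ^+ n)).
have Bn p : act (Bf ^+ n) p = ((p.1 + n%:Z)%R, p.2) by rewrite act_pow_letter.
have aE : act (free_letter (a, false)) ((0 + n%:Z)%R, y) = ((0 + n%:Z)%R,
  s n y).
  by rewrite /act /= /act_letter /= (negbTE ab) eqxx GRing.add0r.
rewrite actM // actM // Bn /= aE.
have -> : ((0 + n%:Z)%R, s n y) = act (Bf ^+ n) (0%R, s n y) by rewrite Bn.
by rewrite actK.
Qed.

End ConjugationCode.

Lemma measurable_act (T : choiceType) (a b : T) d (Y : measurableType d)
    (s : nat -> Y -> Y) (x : free_group T) (n : int) :
  (forall k, measurable_fun setT (s k)) ->
  measurable_fun setT (fun y => (act a b s x (n, y)).2).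
Proof.
move=> ms; rewrite /act; elim: (word x) => [|l w IHw] /=;
  first exact: measurable_id.
rewrite (_ : (fun y => _) = (fun y => (act_letter a b s l
    ((degree_word b w + n)%R, (foldr (act_letter a b s) (n, y) w).2)).2));
      last first.
  apply/funext => y; have := act_degree a b s w (n, y).
  by case: (foldr _ _ w) => m z /= ->.
rewrite /act_letter; case: (l.1 == b) => //=; case: (l.1 == a) => //=.
by case: (degree_word b w + n)%R => // k; exact: (measurableT_comp (ms k) IHw).
Qed.

Theorem theorem2p13 (R : realType) (F : groupType)
  (lt : F -> F -> Prop) (P : set F) (H : groupType) (a : F -> H)
  (F_free : is_free F)
  (F_fg : finitely_generated F)
  (F_nonabelian : ~ abelian_group F)
  (lt_bi_ordering : bi_ordering lt)
  (P_cone : P = positive_cone lt)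
  (H_fg : finitely_generated H)
  (a_central : forall g, P g -> centre (a g))
  (a_free : free_abelian_family P a)
  (bi_orderable_quotients : forall (S : set F) (SP : S `<=` P),
     bi_orderable (quotient (generated_central a_central SP)))
  (conjugate_isomorphic : forall (S S' : set F) (SP : S `<=` P) (S'P : S' `<=` P),
     (exists h : F, S' = [set h * g * h^-1 | g in S]) ->
     group_isomorphic (quotient (generated_central a_central SP))
                      (quotient (generated_central a_central S'P))) :
  weakly_universal R BO_iso.
Proof.
split=> [|d Y E E_cber]; first exact: BO_iso_cber.
have [e [s [einj me ms sK sE]]] := feldman_moore E_cber.
have [T [phi phi_bij]] := F_free.
have [phiinv phiK phiinvK] := phi_bij.
have [t [b tb]] : exists t b : T, t != b.
  apply: contrapT => nex; apply: F_nonabelian => x y.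
  rewrite -(phiinvK x) -(phiinvK y); apply: gmulf_commute.
  apply: free_group_abelian => u v; apply/eqP/negPn/negP => uv; apply: nex.
  by exists u, v.
have [sg b_pos] : exists sg, lt 1 (phi (free_letter (b, sg))).
  have [_ _ tot inv] := lt_bi_ordering.
  have [/esym|pos|neg] := tot 1 (phi (free_letter (b, false))).
  - by rewrite -(morph1 (@gmulfM _ _ phi)) =>
      /(bij_inj phi_bij)/(congr1 (@word T)).
  - by exists false.
  exists true; rewrite (free_letterV (b, false)) (morphV (@gmulfM _ _ phi)).
  by have [+ _] := inv _ _ (phi (free_letter (b, false)))^-1 neg;
    rewrite mulVg mulg1.
pose S y := conj_code phi t b sg e s (0%R, y).
have SP y : S y `<=` P by rewrite P_cone; exact: conj_code_positive.
have SE y i : S y (phi (free_letter (b, sg) ^+ i.+1)) <-> e y i.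
  by have := conj_codeE phi_bij t b sg e sK (0%R, y) i; apply.
have [psi [psiM psi_surj psi_fin]] := Finf_surjection H_fg.
pose f y : BO_space := preimage_point psiM psi_surj psi_fin
  (bi_orderable_quotients _ (SP y)).
have fE y g : val (f y) g <-> generated (a @` S y) (psi g) by exact:
  preimage_pointE.
have fiso y : group_isomorphic (BO_group (f y))
  (quotient (generated_central a_central (SP y))).
  exact: BO_group_preimage.
have [chi [_ /choice[kap kapK] _]] := Finf_surjection F_fg.
have kap_inj : injective kap by move=> x y xy; rewrite -(kapK x) xy kapK.
have mS g : measurable (fun y => S y g).
  apply: (measurable_exists_inj (c := pickle \o (kap \o phi))).
    by apply: inj_comp (pcan_inj pickleK) (inj_comp kap_inj (bij_inj phi_bij)).
  move=> h; apply: measurable_exists => i; apply: measurable_and;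
    first exact: measurable_prop.
  rewrite -[X in measurable X]setTI.
  exact: (measurable_act t b h^-1 0%R ms) _ (me i).
have mgen x : measurable (fun y => generated (a @` S y) x).
  rewrite (_ : (fun y => _) = fun y => exists w,
    (forall p, p \in w -> S y p.1) /\
      x = word_prod a w); last first.
    by apply/seteqP; split=> y /generatedP.
  apply: (measurable_exists_inj (c := fun w =>
    pickle [seq (kap p.1, p.2) | p <- w])).
    apply: inj_comp (pcan_inj pickleK) _; apply: inj_map.
    by move=> [u b1] [v b2] /= [/kap_inj -> ->].
  move=> w; apply: measurable_and; last exact: measurable_prop.
  apply: (measurable_forall_inj (c := fun p => pickle (kap p.1, p.2))).
    by move=> [u b1] [v b2] /(pcan_inj pickleK) [/kap_inj -> ->].
  by move=> p; apply: measurable_imply; [exact: measurable_prop|exact: mS].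
exists f; split.
- move=> _ _ [B mB <-]; rewrite !setTI.
  apply: (measurable_preimage_generated (f := fun y => val (f y)))
    (borel_coordinates mB) => _ [g ->].
  rewrite (_ : _ @^-1` _ = fun y => generated (a @` S y) (psi g));
    first exact: mgen.
  by apply/seteqP; split=> y /fE.
- move=> N; apply/countable_injP; exists (fun=> 0%N) =>
    y y' /set_mem /= fy /set_mem /= fy' _.
  have genE x : generated (a @` S y) x <-> generated (a @` S y') x.
    by have [g <-] := psi_surj x; rewrite -!fE fy fy'.
  have mem u u' i : (forall x, generated (a @` S u) x <->
    generated (a @` S u') x) ->
      e u i -> e u' i.
    move=> uu' /SE Sui; apply/SE; apply:
      (free_generated_mem a_free a_central (SP u')).
      exact: SP Sui.
    by apply/uu' => C [_ aC]; apply: aC;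
      exists (phi (free_letter (b, sg) ^+ i.+1)).
  by apply/einj/funext => i; apply/idP/idP; apply: mem => // x; rewrite genE.
- move=> y y' /sE[n <-].
  apply: (group_isomorphic_trans (fiso y)).
  apply: group_isomorphic_trans (group_isomorphic_sym (fiso (s n y))).
  apply: conjugate_isomorphic.
  have [k kE] := conj_code_move tb sK n y.
  by exists (phi k); rewrite /S -kE conj_code_act.
Qed.
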